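(* The exponent $\lambda_a$ satisfies $$ \lambda_a = \frac{1}{a}\left(\log \left(\frac{1}{a}\right) -1 +o(1)\right)\qquad (a \to 0^+). $$
   Context: Buchstab's function $\omega$: $\omega(u)=0$ for $u<1$, $\omega(u)=1/u$ for $1\le u\le 2$, $\omega$ is continuous on $[1,\infty)$ and $(u\,\omega(u))'=\omega(u-1)$ for $u>2$. $\gamma$ is Euler's constant. For $a>0$ let $$g_a(s)=s + \frac{e^{-\gamma}}{a (1+a)^s} +s \int_1^\infty \bigl( \omega(u) - e^{-\gamma}\bigr) \frac{du}{(1+au)^{s+1}},$$ an entire function of $s$. The number $-\lambda_a$ is defined to be the largest real zero of $g_a$. *)

(* Defs.v *)
From HB Require Import structures.
From mathcomp Require Import all_boot all_order all_algebra.
From mathcomp Require Import all_classical all_reals all_analysis.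

Set Implicit Arguments.
Unset Strict Implicit.
Unset Printing Implicit Defensive.

Import Order.TTheory GRing.Theory Num.Theory.
Import numFieldNormedType.Exports.

Local Open Scope classical_set_scope.
Local Open Scope ring_scope.

Definition euler_gamma (R : realType) : R :=
  limn (fun n : nat => (\sum_(1 <= k < n.+1) (k%:R : R)^-1) - ln (n%:R : R)).

(* These conditions determine omega uniquely on the whole real line.  The
   derivative at u > 2 is two-sided and its existence is part of the
   condition. *)
Definition is_buchstab (R : realType) (omega : R -> R) : Prop :=
  [/\ forall u : R, u < 1 -> omega u = 0,
      forall u : R, 1 <= u <= 2 -> omega u = u^-1,
      {within `[1, +oo[, continuous omega} &
      forall u : R, 2 < u ->
        is_derive u 1 (fun v : R => v * omega v) (omega (u - 1))].

(* The function g_a restricted to the real axis, for a > 0.  For the Buchstab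
   function omega the difference omega u - e^(-gamma) decays faster than any
   exponential, so the integrand is Lebesgue integrable for every real s. *)
Definition g (R : realType) (omega : R -> R) (a s : R) : R :=
  s + expR (- euler_gamma R) / (a * (1 + a) `^ s)
  + s * \int[@lebesgue_measure R]_(u in `[1, +oo[)
          ((omega u - expR (- euler_gamma R)) / (1 + a * u) `^ (s + 1)).

Definition is_largest_zero (R : realType) (f : R -> R) (x : R) : Prop :=
  f x = 0 /\ forall y, f y = 0 -> y <= x.

(* A largest zero is unique when it exists; the default value 0 is returned
   only when there is none. *)
Definition largest_zero (R : realType) (f : R -> R) : R :=
  xget 0 [set x | is_largest_zero f x].

Definition lambda (R : realType) (omega : R -> R) (a : R) : R :=
  - largest_zero (g omega a).

(* Main.v *)
(* The Laplace transform of the Buchstab function gives the limit A = e^(-gamma):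
   G t = t (1 + \int_1^oo omega u e^(-ut) du) satisfies
   G' = G (1 - e^(-t))/t, G(0) = A and G t ~ t.

   With x = 1/a and s = -l, g_a(s) is a positive multiple of a function Q x l
   such that x Q' = (l - 1) Q + Q (x + 1), Q' = l Q(., l - 1) and Q ~ x^l.
   In terms of the contour integral (Gamma (l + 1) / 2 pi i) \oint
   exp (x t - \int_0^t (e^y - 1)/y dy) t^(-l-1) dt for Q, the saddle points
   solve l = x t - e^t + 1; the right-hand side is largest at t = ln x, with
   value x (ln x - 1) + 1, and beyond it the saddle points leave the real line.
   Accordingly Q x l > 0 as long as l - 1 < x (ln x - 1), by comparing Q'/Q with
   ln x, whereas for integer l slightly beyond this bound Q x l must become
   nonpositive. *)
Require Import Defs.
From HB Require Import structures.
From mathcomp Require Import all_boot all_order all_algebra.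
From mathcomp Require Import all_classical all_reals all_analysis.
From mathcomp Require Import measurable_realfun zify ring lra.

Import Order.TTheory GRing.Theory Num.Theory.
Import numFieldNormedType.Exports.

Local Open Scope classical_set_scope.
Local Open Scope ring_scope.

Set Implicit Arguments.
Unset Strict Implicit.
Unset Printing Implicit Defensive.

(** The Laplace transform and Q both integrate [omega u - A] against a kernel, e^(-tu) or (x + u)^(l
    - 1), whose translates in u stay in the same family. A single integration by parts based on (u
    omega(u))' = omega(u - 1), [shifted_ibp], therefore yields both the equation for G' and the
    relation containing Q(x + 1). The contour integral is only a guide: its saddle point T = ln x
    reappears as the slope in the comparison proving positivity and as the ratio of the test weights
    beyond it. Integers l = n are special because Q(., n)/n! is an Appell sequence starting from the
    constant 1: its Taylor expansion stops, and the two relations combine into a recurrence in n at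
    the single point x. The test weights start near x (ln x - 1) + d x and occupy about 2 (ln x)^2 /
    d integers. For fixed d the second length is o(x), so d can be tied to the desired precision
    alone. *)

Lemma continuous_at_within (R : realType) (f : R -> R) (a b : R) :
  (forall x, a <= x <= b -> {for x, continuous f}) ->
  {within `[a, b], continuous f}.
Proof.
move=> cf; apply: continuous_in_subspaceT => x.
by rewrite inE/= in_itv/= => /cf.
Qed.

Lemma is_derive_continuous (R : realType) (f : R -> R) (x d : R) :
  is_derive x 1 f d -> {for x, continuous f}.
Proof. by move=> [df _]; apply/differentiable_continuous/derivable1_diffP. Qed.

Lemma mean_value (R : realType) (f df : R -> R) (a b : R) : a < b ->
  (forall x, a < x < b -> is_derive x 1 f (df x)) ->
  (forall x, a <= x <= b -> {for x, continuous f}) ->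
  exists2 c, a < c < b & f b - f a = df c * (b - a).
Proof.
move=> ab dfP cf.
have dfP' x : x \in `]a, b[ -> is_derive x 1 f (df x).
  by rewrite in_itv/= => /dfP.
have [c] := MVT ab dfP' (continuous_at_within cf).
by rewrite in_itv/=; exists c.
Qed.

Lemma derive_le (R : realType) (f g df dg : R -> R) (a b : R) : a <= b ->
  (forall x, a < x < b -> is_derive x 1 f (df x)) ->
  (forall x, a < x < b -> is_derive x 1 g (dg x)) ->
  (forall x, a <= x <= b -> {for x, continuous f}) ->
  (forall x, a <= x <= b -> {for x, continuous g}) ->
  (forall x, a < x < b -> df x <= dg x) ->
  f b - f a <= g b - g a.
Proof.
rewrite le_eqVlt => /predU1P[<-|ab]; first by rewrite !subrr.
move=> dfP dgP cf cg le_df.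
have [x xab|x xab|c cab] := @mean_value R (g - f) (dg - df) a b ab.
- exact: is_deriveB (dgP _ xab) (dfP _ xab).
- by apply: continuousB; [exact: cg|exact: cf].
- rewrite !fctE => H.
  have : 0 <= (dg c - df c) * (b - a).
    by rewrite mulr_ge0// subr_ge0; [exact: le_df|exact: ltW].
  by rewrite -H; lra.
Qed.

Lemma is_derive_exprn (R : realType) (n : nat) (x : R) :
  is_derive x 1 (fun y : R => y ^+ n) (n%:R * x ^+ n.-1).
Proof.
have := is_deriveX n (is_derive_id x (1 : R)).
rewrite (_ : id ^+ n = (fun y : R => y ^+ n)); last by apply/funext => y; rewrite fctE.
by move=> h; refine (is_derive_eq h _); rewrite /GRing.scale/= mulr1.
Qed.

(** * Bounds for [omega] and its rapid convergence to a limit *)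

Section buchstab.
Context {R : realType} {omega : R -> R} (omegaP : is_buchstab omega).

Lemma buchstab_continuous (u : R) : 1 < u -> {for u, continuous omega}.
Proof.
move=> u1; have [_ _ /continuous_within_itvcyP[c _] _] := omegaP.
by apply: c; rewrite in_itv/= u1.
Qed.

Lemma buchstab_mulr_continuous (u : R) : 1 < u ->
  {for u, continuous (fun v : R => v * omega v)}.
Proof.
by move=> u1; apply: continuousM; [exact: cvg_id|exact: buchstab_continuous].
Qed.

Lemma buchstab_is_derive (u : R) : 2 < u ->
  is_derive u 1 omega ((omega (u - 1) - omega u) / u).
Proof.
move=> u2; have [_ _ _ /(_ _ u2) h] := omegaP.
have u0 : u != 0 by rewrite gt_eqF//; lra.
have := is_deriveM h (is_deriveV u0 (is_derive_id u 1)).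
move=> H; refine (near_eq_is_derive _ (is_derive_eq H _)); last first.
  by rewrite /GRing.scale/=; field.
near=> v; rewrite !fctE/=.
have v0 : v != 0.
  by rewrite gt_eqF//; near: v; apply: lt_nbhsr; lra.
by field.
Unshelve. all: by end_near. Qed.

(** By the mean value theorem u omega(u) = N omega(N) + (u - N) omega(c - 1), so omega(u) is a
    weighted mean of two earlier values, and the bounds valid on [1, 2] propagate. *)
Lemma buchstab_bounds (u : R) : 1 <= u -> 2^-1 <= omega u <= 1.
Proof.
have [_ om12 _ dom] := omegaP.
have base v : 1 <= v <= 2 -> 2^-1 <= omega v <= 1.
  move=> /[dup] v12 /om12 ->.
  by rewrite lef_pV2 ?posrE ?invf_le1; lra.
move=> u1; have [n un] : exists n : nat, u <= n.+2%:R.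
  exists (Num.bound u); have u0 : 0 <= u by lra.
  have := archi_boundP u0.
  have : (Num.bound u)%:R <= (Num.bound u).+2%:R :> R by rewrite ler_nat; do 2 apply: leqW.
  lra.
elim: n u u1 un => [|n IHn] u u1 un; first by apply: base; rewrite u1.
have [|nu] := leP u n.+2%:R; first exact: IHn.
have n2 : 2 <= n.+2%:R :> R by rewrite ler_nat.
have [x|x|c cin] := mean_value nu (df := fun v => omega (v - 1)) (f := fun v => v * omega v).
- by move=> xin; apply: dom; lra.
- by move=> xin; apply: buchstab_mulr_continuous; lra.
have un' : u <= n.+2%:R + 1 by rewrite -natr1 in un.
have /IHn : 1 <= c - 1 by lra.
move=> /(_ ltac:(lra)) hc.
have /IHn : 1 <= n.+2%:R :> R by lra.
move=> /(_ (lexx _)) hn.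
set N := n.+2%:R in hn nu cin n2 un' *; move=> E.
have u0 : 0 < u by lra.
apply/andP; split.
  rewrite -(ler_pM2l u0); nra.
rewrite -(ler_pM2l u0); nra.
Qed.

(** The quotient is omega'(u), an increment of [omega] over unit length divided by u. The mean value
    theorem turns the increment into an earlier value of omega', so each round gains a factor
    1/u. *)
Lemma buchstab_derive_decay (p : nat) : exists2 C : R, 0 <= C &
  forall u : R, 2 < u -> `|(omega (u - 1) - omega u) / u| <= C / u ^+ p.
Proof.
have bd u : 2 < u -> `|(omega (u - 1) - omega u) / u| <= 1.
  move=> u2; have /andP[a1 a2] := @buchstab_bounds u ltac:(lra).
  have /andP[b1 b2] := @buchstab_bounds (u - 1) ltac:(lra).
  rewrite normrM normfV ler_pdivrMr ?normr_gt0 ?gt_eqF ?mul1r//; last lra.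
  by rewrite (@ger0_norm _ u)  ?ler_norml; [|lra]; apply/andP; split; lra.
elim: p => [|p [C C0 IHp]].
  by exists 1 => // u u2; rewrite expr0 divr1; exact: bd.
exists (C * 2 ^+ p + 3 ^+ p.+1) => [|u u2].
  by rewrite addr_ge0// ?mulr_ge0// exprn_ge0.
have u0 : 0 < u by lra.
have up q : 0 < u ^+ q by rewrite exprn_gt0.
(* For u <= 3 the mean value point could fall below 2, where the differential equation is not given;
   the term 3^(p+1) covers this range. *)
have [u3|u3] := leP u 3.
  apply: (le_trans (bd _ u2)); rewrite ler_pdivlMr// mul1r.
  apply: (@le_trans _ _ (3 ^+ p.+1)).
    by rewrite lerXn2r ?nnegrE; lra.
  by rewrite lerDr mulr_ge0// exprn_ge0.
have [x xin|x xin|c cin] := @mean_value R omega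
    (fun u => (omega (u - 1) - omega u) / u) (u - 1) u ltac:(lra).
- by apply: buchstab_is_derive; lra.
- by apply: buchstab_continuous; lra.
have -> : u - (u - 1) = 1 by ring.
rewrite mulr1 => E.
have c0 : 0 < c by lra.
rewrite normrM distrC E normfV (gtr0_norm u0) (exprS u) invfM mulrA.
rewrite [leRHS]mulrAC ler_pM2r ?invr_gt0//.
apply: (le_trans (IHp c ltac:(lra))).
(* Since c > u - 1 >= u/2, passing from c^p to u^p costs at most 2^p. *)
rewrite mulrDl; apply: (@le_trans _ _ (C * 2 ^+ p / u ^+ p)); last first.
  by rewrite lerDl divr_ge0// ltW// exprn_gt0.
rewrite -mulrA ler_wpM2l// -[2 ^+ p]invrK -invfM lef_pV2 ?posrE ?exprn_gt0//; last first.
  by rewrite mulr_gt0 ?invr_gt0 ?exprn_gt0.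
rewrite mulrC -expr_div_n lerXn2r ?nnegrE; lra.
Qed.

(** Instead of integrating omega', [omega] is compared with - C / x^(p+1), whose derivative (p + 1)
    C / x^(p+2) dominates |omega'|. *)
Lemma buchstab_oscillation (p : nat) : exists2 C : R, 0 <= C &
  forall u v : R, 2 <= u -> u <= v -> `|omega v - omega u| <= C / u ^+ p.+1.
Proof.
have [C C0 decay] := buchstab_derive_decay p.+2.
exists C => // u v u2 uv.
pose g (x : R) := - (C / x ^+ p.+1).
have dg (x : R) : 0 < x -> is_derive x 1 g (C * p.+1%:R / x ^+ p.+2).
  move=> x0; have xn0 : x ^+ p.+1 != 0 by rewrite gt_eqF// exprn_gt0.
  have := is_deriveN (is_deriveZ C (@is_deriveV R (fun y => y ^+ p.+1) x _ 1 xn0 (is_derive_exprn p.+1 x))).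
  move=> H; refine (is_derive_eq H _).
  rewrite /GRing.scale/= ?mulr1 !exprS.
  have : x ^+ p != 0 by rewrite gt_eqF// exprn_gt0.
  set y := x ^+ p; move=> y0.
  have x00 : x != 0 by rewrite gt_eqF.
  by field; rewrite ?x00 ?y0.
have cg (x : R) : u <= x <= v -> {for x, continuous g}.
  by move=> xuv; apply: is_derive_continuous (dg x _); lra.
have co (x : R) : u <= x <= v -> {for x, continuous omega}.
  by move=> xuv; apply: buchstab_continuous; lra.
have gle (x : R) : u < x < v -> C / x ^+ p.+2 <= C * p.+1%:R / x ^+ p.+2.
  move=> xuv; have x0 : 0 < x by lra.
  have xn0 : 0 < (x ^+ p.+2)^-1 by rewrite invr_gt0 exprn_gt0.
  rewrite (ler_pM2r xn0).
  by rewrite ler_peMr// ler1n.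
have dw (x : R) : u < x < v ->
    is_derive x 1 omega ((omega (x - 1) - omega x) / x).
  by move=> xuv; apply: buchstab_is_derive; lra.
have dg' (x : R) : u < x < v -> is_derive x 1 g (C * p.+1%:R / x ^+ p.+2).
  by move=> xuv; apply: dg; lra.
have dNg (x : R) : u < x < v -> is_derive x 1 (- g) (- (C * p.+1%:R / x ^+ p.+2)).
  by move=> /dg' h; exact: is_deriveN.
have cNg (x : R) : u <= x <= v -> {for x, continuous (- g)}.
  by move=> xuv; apply: continuousN; exact: cg.
have H1 : omega v - omega u <= g v - g u.
  apply: (derive_le uv dw dg' co cg) => x xuv; apply: le_trans (gle x xuv).
  by apply: (le_trans (ler_norm _)); apply: decay; lra.
have H2 : (- g) v - (- g) u <= omega v - omega u.
  apply: (derive_le uv dNg dw cNg co) => x xuv.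
  rewrite lerNl; apply: le_trans (gle x xuv).
  rewrite (le_trans _ (decay x _))//; [|lra].
  by rewrite -normrN ler_norm.
have gv : g v <= 0 by rewrite /g oppr_le0 divr_ge0// exprn_ge0//; lra.
rewrite !fctE in H2; rewrite ler_norml {2}/g in H1 H2 *.
by rewrite -/(g v) /g in H1 H2 gv *; apply/andP; split; lra.
Qed.

Lemma buchstab_limit : exists2 A : R, 2^-1 <= A & forall p : nat,
  exists2 C : R, 0 <= C & forall u : R, 1 <= u -> `|omega u - A| <= C / u ^+ p.
Proof.
have [C1 C10 osc1] := buchstab_oscillation 0.
(* By the oscillation bound each omega(v) + C1/v is above every omega(u) - C1/u, so sup E differs
   from omega(v) by at most C1/v: it is the limit. *)
pose E := [set omega u - C1 / u | u in [set u : R | 2 <= u]].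
have Eub v : 2 <= v -> ubound E (omega v + C1 / v).
  move=> v2 _ [u /= u2 <-].
  have [uv|/ltW vu] := leP u v.
    have := osc1 u v u2 uv; rewrite expr1 ler_norml => /andP[h _].
    have : 0 <= C1 / v by rewrite divr_ge0//; lra.
    lra.
  have := osc1 v u v2 vu; rewrite expr1 ler_norml => /andP[_ h].
  have : 0 <= C1 / u by rewrite divr_ge0//; lra.
  lra.
have E2 : E (omega 2 - C1 / 2) by exists 2 => //=.
have hsE : has_sup E.
  by split; [exists (omega 2 - C1 / 2)|exists (omega 2 + C1 / 2); exact: Eub].
pose A := sup E.
have approx e : 0 < e -> exists v, [/\ 2 <= v, omega v - e <= A & A <= omega v + e].
  move=> e0; pose v := 2 + C1 / e.
  have v2 : 2 <= v by rewrite lerDl divr_ge0// ltW.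
  have Cv : C1 / v <= e.
    rewrite ler_pdivrMr; [|lra].
    by rewrite /v mulrDr mulrCA divff ?gt_eqF// mulr1; lra.
  have h1 : omega v - C1 / v <= A by apply: ub_le_sup; [exact: hsE.2|exists v].
  have h2 : A <= omega v + C1 / v by apply: ge_sup; [exact: hsE.1|exact: Eub].
  by exists v; split; lra.
have A1 : 2^-1 <= A.
  apply/ler_addgt0Pr => e /approx[v [v2 h _]].
  by have := @buchstab_bounds v ltac:(lra); lra.
have A2 : A <= 1.
  apply/ler_addgt0Pr => e /approx[v [v2 _ h]].
  by have := @buchstab_bounds v ltac:(lra); lra.
exists A => // p; have [C C0 osc] := buchstab_oscillation p.
exists (C + 2 ^+ p) => [|u u1]; first by rewrite addr_ge0// exprn_ge0.
have up : 0 < u ^+ p by rewrite exprn_gt0//; lra.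
have [u2|u2] := leP 2 u; last first.
  have hu := buchstab_bounds u1.
  apply: (@le_trans _ _ 1); first by rewrite ler_norml; apply/andP; split; lra.
  rewrite ler_pdivlMr// mul1r (@le_trans _ _ (2 ^+ p)) ?lerDr//.
  by rewrite lerXn2r ?nnegrE; lra.
apply/ler_addgt0Pr => e e0.
pose v := u + C1 / e.
have uv : u <= v by rewrite lerDl divr_ge0// ltW.
have v2 : 2 <= v by lra.
have Cv : C1 / v <= e.
  rewrite ler_pdivrMr; [|lra].
  rewrite /v mulrDr mulrCA divff ?gt_eqF// mulr1.
  have : 0 <= e * u by apply: mulr_ge0; lra.
  lra.
have h1 : omega v - C1 / v <= A by apply: ub_le_sup; [exact: hsE.2|exists v].
have h2 : A <= omega v + C1 / v by apply: ge_sup; [exact: hsE.1|exact: Eub].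
have Cle : C / u ^+ p.+1 <= (C + 2 ^+ p) / u ^+ p.
  apply: (@le_trans _ _ (C / u ^+ p)).
    have u0 : 0 < u by lra.
    rewrite ler_wpM2l// lef_pV2 ?posrE ?exprn_gt0//.
    by rewrite exprS ler_peMl// ltW.
  by rewrite ler_pM2r ?invr_gt0// lerDl exprn_ge0.
have := osc u v u2 uv; rewrite !ler_norml => /andP[g1 g2].
by apply/andP; split; lra.
Qed.

End buchstab.

(** * Integrals over half-lines dominated by a multiple of u^(-2) *)

Section inverse_square.
Context {R : realType}.
Local Notation mu := (@lebesgue_measure R).

Lemma within_itvcy_continuous (f : R -> R) (a : R) :
  (forall u, a <= u -> {for u, continuous f}) -> {within `[a, +oo[, continuous f}.
Proof.
move=> cf; apply: continuous_in_subspaceT => x.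
by rewrite inE/= in_itv/= andbT => /cf.
Qed.

Lemma measurable_itvcy (f : R -> R) (a : R) :
  (forall u, a <= u -> {for u, continuous f}) ->
  measurable_fun `[a, +oo[ f.
Proof.
move=> cf; apply: subspace_continuous_measurable_fun => //.
exact: within_itvcy_continuous.
Qed.

Lemma is_derive_invN (x : R) : 0 < x ->
  is_derive x 1 (fun y : R => - y^-1) (x ^- 2).
Proof.
move=> x0; have xn0 : x != 0 by rewrite gt_eqF.
have h := is_deriveN (@is_deriveV R id x _ 1 xn0 (is_derive_id x 1)).
by refine (is_derive_eq h _); rewrite /GRing.scale/= mulr1 opprK.
Qed.

Lemma continuous_invsq (x : R) : 0 < x -> {for x, continuous (fun y : R => y ^- 2)}.
Proof.
move=> x0; apply: continuousV; first by rewrite expf_neq0// gt_eqF.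
exact: exprn_continuous.
Qed.

Lemma integral_invsq (a : R) : 0 < a ->
  (\int[mu]_(x in `[a, +oo[) (x ^- 2)%:E = (a^-1)%:E)%E.
Proof.
move=> a0; rewrite (@ge0_continuous_FTC2y R _ (fun y : R => - y^-1) a 0).
- by rewrite -EFinB sub0r opprK.
- by move=> x ax; rewrite invr_ge0 exprn_ge0// (le_trans (ltW a0)).
- by apply: within_itvcy_continuous => u au; apply: continuous_invsq; apply: lt_le_trans au.
- rewrite -oppr0; apply: cvgN; apply/(@gtr0_cvgV0 _ _ _ _ (fun x : R => x)).
    exact: nbhs_pinfty_gt.
  exact: cvg_id.
- by move=> x ax; have [] := is_derive_invN (lt_trans a0 ax).
- apply: cvg_at_right_filter.
  exact: is_derive_continuous (is_derive_invN a0).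
- move=> x; rewrite in_itv/= andbT => ax.
  by rewrite derive1E; have [_ ->] := is_derive_invN (lt_trans a0 ax).
Qed.

Lemma integrable_invsq (a K : R) : 0 < a ->
  mu.-integrable `[a, +oo[ (EFin \o (fun x => K * x ^- 2)).
Proof.
move=> a0; suff h : mu.-integrable `[a, +oo[ (EFin \o (fun x => x ^- 2)).
  have := @integrableZl _ _ R mu `[a, +oo[ (measurable_itv _) K _ h.
  by move=> h1; apply: eq_integrable h1 => // x _; rewrite /= EFinM.
apply/integrableP; split.
  apply/measurable_EFinP; apply: measurable_itvcy => u au.
  by apply: continuous_invsq; apply: lt_le_trans au.
rewrite [ltLHS](_ : _ = (a^-1)%:E) ?ltry// -integral_invsq//.
apply: eq_integral => x _ /=.
by rewrite ger0_norm// invr_ge0 exprn_even_ge0.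
Qed.

Lemma Rintegral_invsq (a K : R) : 0 < a ->
  \int[mu]_(x in `[a, +oo[) (K * x ^- 2) = K / a.
Proof.
move=> a0; rewrite RintegralZl//; last first.
  have h1 := integrable_invsq 1 a0; apply: eq_integrable h1 => // x _.
  by rewrite /= mul1r.
by rewrite /Rintegral integral_invsq.
Qed.

Lemma integrable_le_invsq (f : R -> R) (a K : R) : 0 < a ->
  measurable_fun `[a, +oo[ f ->
  (forall u, a <= u -> `|f u| <= K * u ^- 2) ->
  mu.-integrable `[a, +oo[ (EFin \o f).
Proof.
move=> a0 mf fK; apply: (le_integrable _ _ _ (integrable_invsq K a0)) => //.
  exact/measurable_EFinP.
move=> x /=; rewrite in_itv/= andbT => ax.
by rewrite lee_fin (le_trans (fK _ ax)) ?ler_norm.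
Qed.

Lemma Rintegral_le_invsq (f : R -> R) (a K : R) : 0 < a ->
  measurable_fun `[a, +oo[ f ->
  (forall u, a <= u -> `|f u| <= K * u ^- 2) ->
  `|\int[mu]_(x in `[a, +oo[) f x| <= K / a.
Proof.
move=> a0 mf fK; have fi := integrable_le_invsq a0 mf fK.
rewrite (le_trans (le_normr_Rintegral _ _))// -Rintegral_invsq//.
apply: le_Rintegral => //; first exact: integrable_norm.
  exact: integrable_invsq.
by move=> x /=; rewrite in_itv/= andbT => /fK.
Qed.

(** The explicit rate lets an identity proved on [1, y] pass to the half-line through
    [eq0_le_div]. *)
Lemma Rintegral_truncate (f : R -> R) (K y : R) : 1 <= y ->
  measurable_fun `[(1 : R), +oo[ f ->
  (forall u, 1 <= u -> `|f u| <= K * u ^- 2) ->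
  `|\int[mu]_(x in `[(1 : R), +oo[) f x - \int[mu]_(x in `[(1 : R), y]) f x| <= K / y.
Proof.
move=> y1 mf fK; have y0 : 0 < y by rewrite (lt_le_trans ltr01).
have fi := integrable_le_invsq ltr01 mf fK.
rewrite (Rintegral_itvB fi) ?bnd_simp//.
have sub : `[y, +oo[ `<=` `[(1 : R), +oo[.
  by apply: subset_itvr; rewrite bnd_simp.
rewrite Rintegral_itv_obnd_cbnd; last first.
  by apply: integrableS fi => //; apply: subset_itvr; rewrite bnd_simp.
apply: Rintegral_le_invsq => //; first exact: measurable_funS mf.
by move=> u yu; apply: fK; exact: le_trans yu.
Qed.

Lemma is_derive_Rintegral (f : R -> R) (y : R) : 1 < y ->
  mu.-integrable `[(1 : R), +oo[ (EFin \o f) -> {for y, continuous f} ->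
  is_derive y 1 (fun z => \int[mu]_(x in `[(1 : R), z]) f x) (f y).
Proof.
move=> y1 fi cf.
have fi' : mu.-integrable `[1, (y + 1)] (EFin \o f).
  by apply: integrableS fi => //; apply: subset_itvl; rewrite bnd_simp.
have yy1 : y < y + 1 by rewrite ltrDl.
have [d e] := continuous_FTC1_closed yy1 fi' y1 cf.
by rewrite derive1E in e; exact: DeriveDef d e.
Qed.

(** The endpoint is treated apart because the integrands of interest contain [omega], which jumps at
    1, so the fundamental theorem cannot be applied there. *)
Lemma continuous_Rintegral1 (f : R -> R) :
  mu.-integrable `[(1 : R), +oo[ (EFin \o f) ->
  {for (1 : R), continuous (fun z => \int[mu]_(x in `[(1 : R), z]) f x)}.
Proof.
move=> fi.
have fi' : mu.-integrable `[(1:R), 2] (EFin \o f).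
  by apply: integrableS fi => //; apply: subset_itvl; rewrite bnd_simp.
have := @parameterized_integral_cvg_left R 1 2 f ltac:(lra) fi'.
by rewrite /parameterized_integral /prop_for /continuous_at set_itv1 Rintegral_set1.
Qed.

End inverse_square.

(** * Functions of polynomial growth integrated against a rapidly decaying weight *)

Definition weighted (R : realType) (v psi : R -> R) : R :=
  \int[@lebesgue_measure R]_(u in `[(1 : R), +oo[) (v u * psi u).

Definition rapid_decay (R : realType) (v : R -> R) := forall p : nat,
  exists2 C : R, 0 <= C & forall u : R, 1 <= u -> `|v u| <= C / u ^+ p.

Section weighted.
Context {R : realType} {v : R -> R}.
Hypothesis mv : measurable_fun `[(1 : R), +oo[ v.
Hypothesis dv : rapid_decay v.
Local Notation mu := (@lebesgue_measure R).
Local Notation W := (weighted v).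

(** Decay of order q + 2 leaves u^(-2). The constant [C] precedes [K] and [psi], so it is uniform
    over families of test functions. *)
Lemma weighted_le_invsq (q : nat) : exists2 C : R, 0 <= C &
  forall (K : R) (psi : R -> R),
  (forall u : R, 1 <= u -> `|psi u| <= K * u ^+ q) ->
  forall u : R, 1 <= u -> `|v u * psi u| <= (K * C) * u ^- 2.
Proof.
have [C C0 vC] := dv q.+2; exists C => // K psi psiK u u1.
have u0 : 0 < u by rewrite (lt_le_trans ltr01).
rewrite normrM (le_trans (ler_pM _ _ (vC _ u1) (psiK _ u1)))//.
rewrite le_eqVlt; apply/orP; left; apply/eqP.
rewrite -addn2 exprD.
have uq : u ^+ q != 0 by rewrite expf_neq0// gt_eqF.
have un : u != 0 by rewrite gt_eqF.
by field; rewrite uq un.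
Qed.

Lemma weighted_measurable (psi : R -> R) :
  (forall u : R, 1 <= u -> {for u, continuous psi}) ->
  measurable_fun `[(1 : R), +oo[ (fun u => v u * psi u).
Proof. by move=> cpsi; apply: measurable_funM => //; exact: measurable_itvcy. Qed.

Lemma weighted_integrable (K : R) (q : nat) (psi : R -> R) :
  (forall u : R, 1 <= u -> {for u, continuous psi}) ->
  (forall u : R, 1 <= u -> `|psi u| <= K * u ^+ q) ->
  mu.-integrable `[(1 : R), +oo[ (EFin \o (fun u => v u * psi u)).
Proof.
move=> cpsi psiK; have [C C0 h] := weighted_le_invsq q.
exact: (integrable_le_invsq ltr01 (weighted_measurable cpsi) (h _ _ psiK)).
Qed.

Lemma weighted_le (q : nat) : exists2 C : R, 0 <= C &
  forall (K : R) (psi : R -> R),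
  (forall u : R, 1 <= u -> {for u, continuous psi}) ->
  (forall u : R, 1 <= u -> `|psi u| <= K * u ^+ q) ->
  `|W psi| <= K * C.
Proof.
have [C C0 h] := weighted_le_invsq q; exists C => // K psi cpsi psiK.
have := Rintegral_le_invsq ltr01 (weighted_measurable cpsi) (h _ _ psiK).
by rewrite divr1.
Qed.

Lemma weightedD (K : R) (q : nat) (psi phi : R -> R) :
  (forall u : R, 1 <= u -> {for u, continuous psi}) ->
  (forall u : R, 1 <= u -> `|psi u| <= K * u ^+ q) ->
  (forall u : R, 1 <= u -> {for u, continuous phi}) ->
  (forall u : R, 1 <= u -> `|phi u| <= K * u ^+ q) ->
  W (fun u => psi u + phi u) = W psi + W phi.
Proof.
move=> cpsi psiK cphi phiK; rewrite /weighted -RintegralD//.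
- by apply: eq_Rintegral => u _; rewrite mulrDr.
- exact: weighted_integrable psiK.
- exact: weighted_integrable phiK.
Qed.

Lemma weightedZ (K a : R) (q : nat) (psi : R -> R) :
  (forall u : R, 1 <= u -> {for u, continuous psi}) ->
  (forall u : R, 1 <= u -> `|psi u| <= K * u ^+ q) ->
  W (fun u => a * psi u) = a * W psi.
Proof.
move=> cpsi psiK; rewrite /weighted -RintegralZl//.
- by apply: eq_Rintegral => u _; rewrite mulrCA.
- exact: weighted_integrable psiK.
Qed.

Lemma eq_weighted (psi phi : R -> R) :
  (forall u : R, 1 <= u -> psi u = phi u) -> W psi = W phi.
Proof.
move=> e; apply: eq_Rintegral => u; rewrite inE/= in_itv/= andbT => u1.
by rewrite e.
Qed.

Lemma weighted_is_derive (K : R) (q : nat) (a l r : R) (psi dpsi : R -> R -> R) :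
  l < a < r ->
  (forall x u : R, l < x < r -> 1 <= u -> {for u, continuous (psi x)}) ->
  (forall x u : R, l < x < r -> 1 <= u -> `|psi x u| <= K * u ^+ q) ->
  (forall x u : R, l < x < r -> 1 <= u ->
    is_derive x 1 (fun y => psi y u) (dpsi x u)) ->
  (forall x u : R, l < x < r -> 1 <= u -> `|dpsi x u| <= K * u ^+ q) ->
  is_derive a 1 (fun x => W (psi x)) (W (dpsi a)).
Proof.
move=> lar cpsi psiK dpsiP dpsiK.
have [C C0 hC] := weighted_le_invsq q.
pose f (x u : R) := v u * psi x u.
have K0 : 0 <= K by have := psiK a 1 lar (lexx _); rewrite expr1n mulr1; apply: le_trans.
have df (x u : R) : l < x < r -> 1 <= u -> is_derive x 1 (f ^~ u) (v u * dpsi x u).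
  move=> lxr u1; have h := is_deriveZ (v u) (dpsiP x u lxr u1).
  exact: h.
have intf x : `]l, r[%classic x -> mu.-integrable `[(1 : R), +oo[ (EFin \o f x).
  rewrite /= in_itv/= => lxr; apply: (@weighted_integrable K q).
    by move=> u; exact: cpsi.
  by move=> u; exact: psiK.
have derf (x : R) (u : R) : `]l, r[%classic x -> `[(1 : R), +oo[%classic u ->
    derivable (f ^~ u) x 1.
  by rewrite /= !in_itv/= andbT => lxr u1; have [] := df _ _ lxr u1.
have d1 (x : R) (u : R) : l < x < r -> 1 <= u -> partial1of2 f x u = v u * dpsi x u.
  by move=> lxr u1; rewrite partial1of2E; have [_ ->] := df _ _ lxr u1.
pose G (u : R) := K * C * u ^- 2.
have G0 u : 0 <= G u by rewrite mulr_ge0 ?mulr_ge0// invr_ge0 exprn_even_ge0.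
have intG : mu.-integrable `[(1 : R), +oo[ (EFin \o G) by exact: integrable_invsq.
have Gub (x : R) (u : R) : `]l, r[%classic x -> `[(1 : R), +oo[%classic u ->
    `|partial1of2 f x u| <= G u.
  rewrite /= !in_itv/= andbT => lxr u1; rewrite d1//.
  by apply: (hC K (dpsi x)) => // w w1; exact: dpsiK.
have Ia : `]l, r[%classic a by rewrite /= in_itv.
have D1 := @derivable_under_integral R _ _ mu f _ (measurable_itv _) a l r Ia intf derf G G0 intG Gub.
have D2 := @differentiation_under_integral R _ _ mu f _ (measurable_itv _) a l r Ia intf derf G G0 intG Gub.
split; first exact: D1.
rewrite -derive1E D2; apply: eq_Rintegral => u.
rewrite inE/= in_itv/= andbT => u1.
by rewrite -/(partial1of2 f a u) d1.
Qed.

End weighted.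

Section pointwise_derivatives.
Context {R : realType}.
Implicit Types (f g : R -> R) (x a b k : R).

Lemma is_derive1D f g x a b : is_derive x 1 f a -> is_derive x 1 g b ->
  is_derive x 1 (fun y => f y + g y) (a + b).
Proof. exact: is_deriveD. Qed.

Lemma is_derive1B f g x a b : is_derive x 1 f a -> is_derive x 1 g b ->
  is_derive x 1 (fun y => f y - g y) (a - b).
Proof. exact: is_deriveB. Qed.

Lemma is_derive1M f g x a b : is_derive x 1 f a -> is_derive x 1 g b ->
  is_derive x 1 (fun y => f y * g y) (f x * b + g x * a).
Proof. exact: is_deriveM. Qed.

Lemma is_derive1Z f k x a : is_derive x 1 f a ->
  is_derive x 1 (fun y => k * f y) (k * a).
Proof. exact: is_deriveZ. Qed.

Lemma is_derive1_cst k x : is_derive x 1 (fun=> k) 0.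
Proof. exact: is_derive_cst. Qed.

Lemma is_derive1_id x : is_derive x 1 (fun y => y) 1.
Proof. exact: is_derive_id. Qed.

End pointwise_derivatives.

Lemma derive_ge0_le (R : realType) (f df : R -> R) (a b : R) : a <= b ->
  (forall x : R, a < x < b -> is_derive x 1 f (df x)) ->
  (forall x : R, a <= x <= b -> {for x, continuous f}) ->
  (forall x : R, a < x < b -> 0 <= df x) -> f a <= f b.
Proof.
move=> ab dfP cf df0.
have := @derive_le R (fun=> 0) f (fun=> 0) df a b ab
  (fun x _ => is_derive1_cst 0 x) dfP (fun x _ => @cst_continuous _ _ 0 x) cf df0.
by rewrite subrr subr_ge0.
Qed.

Lemma eq0_le_div (R : realType) (x M : R) :
  (forall y : R, 2 <= y -> `|x| <= M / y) -> x = 0.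
Proof.
move=> h; apply/eqP; rewrite -normr_le0; apply/ler_addgt0Pr => e e0; rewrite add0r.
have M0 : 0 <= M.
  by have := le_trans (normr_ge0 x) (h 2 (lexx _)); rewrite pmulr_lge0.
have y0 : 0 <= M / e by rewrite divr_ge0// ltW.
have y2 : 2 <= 2 + M / e by lra.
apply: le_trans (h _ y2) _.
rewrite ler_pdivrMr; last lra.
by rewrite mulrDr mulrCA divff ?gt_eqF// mulr1; lra.
Qed.

Lemma constant_segment (R : realType) (f : R -> R) (a b : R) : a <= b ->
  (forall x, a < x < b -> is_derive x 1 f 0) ->
  (forall x, a <= x <= b -> {for x, continuous f}) -> f b = f a.
Proof.
rewrite le_eqVlt => /predU1P[->//|ab] df cf.
have [c _] := mean_value ab (df := fun=> 0) df cf.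
by rewrite mul0r => /eqP; rewrite subr_eq0 => /eqP.
Qed.

(** * Integration by parts through the delay equation *)

Section shifted_ibp.
Context {R : realType} {omega : R -> R} (omegaP : is_buchstab omega).
Context {A : R} (decayA : rapid_decay (fun u => omega u - A)).
Local Notation v := (fun u : R => omega u - A).
Local Notation mu := (@lebesgue_measure R).

Lemma weight_measurable : measurable_fun `[(1 : R), +oo[ v.
Proof.
apply: measurable_funB; last exact: measurable_cst.
by have [_ _ c _] := omegaP; exact: subspace_continuous_measurable_fun.
Qed.

Lemma weight_continuous (u : R) : 1 < u -> {for u, continuous v}.
Proof.
move=> u1; apply: continuousB; first exact: (buchstab_continuous omegaP).
exact: cst_continuous.
Qed.

Lemma weight_mulr_is_derive (u : R) : 2 < u ->
  is_derive u 1 (fun w : R => w * (omega w - A)) (omega (u - 1) - A).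
Proof.
move=> u2; have [_ _ _ /(_ _ u2) h] := omegaP.
have h2 := is_derive1B h (is_derive1Z A (is_derive1_id u)).
rewrite (_ : (fun w : R => w * (omega w - A)) =
    (fun w : R => w * omega w - A * w)); last by apply/funext => w; ring.
by refine (is_derive_eq h2 _); rewrite mulr1.
Qed.

Variables (psi dpsi Psi : R -> R) (K : R) (q : nat).
Hypothesis dpsiP : forall u : R, 1 <= u -> is_derive u 1 psi (dpsi u).
Hypothesis PsiP : forall u : R, 1 <= u -> is_derive u 1 Psi (psi u).
Hypothesis cdpsi : forall u : R, 1 <= u -> {for u, continuous dpsi}.
Hypothesis psiK : forall u : R, 1 <= u -> `|psi u| <= K * u ^+ q.
Hypothesis dpsiK : forall u : R, 1 <= u -> `|dpsi u| <= K * u ^+ q.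

Let cpsi (u : R) : 1 <= u -> {for u, continuous psi}.
Proof. by move=> u1; exact: is_derive_continuous (dpsiP u1). Qed.

Let K0 : 0 <= K.
Proof. by have := psiK (lexx 1); rewrite expr1n mulr1; apply: le_trans. Qed.

Let f1 (u : R) := u * dpsi u.
Let f2 (u : R) := psi (u + 1).

Let cf1 (u : R) : 1 <= u -> {for u, continuous f1}.
Proof. by move=> u1; apply: continuousM; [exact: cvg_id|exact: cdpsi]. Qed.

Let cf2 (u : R) : 1 <= u -> {for u, continuous f2}.
Proof.
move=> u1; apply: (@continuous_comp _ _ _ (fun w : R => w + 1) psi).
  by apply: continuousD; [exact: cvg_id|exact: cst_continuous].
by apply: cpsi; lra.
Qed.

Let f1K (u : R) : 1 <= u -> `|f1 u| <= (K * 2 ^+ q) * u ^+ q.+1.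
Proof.
move=> u1; rewrite normrM exprS ger0_norm; last lra.
rewrite mulrCA ler_wpM2l//; first lra.
apply: (le_trans (dpsiK u1)); rewrite ler_wpM2r ?exprn_ge0//; first lra.
by rewrite ler_peMr// exprn_ege1//; lra.
Qed.

Let f2K (u : R) : 1 <= u -> `|f2 u| <= (K * 2 ^+ q) * u ^+ q.+1.
Proof.
move=> u1; rewrite /f2; have u2 : 1 <= u + 1 by lra.
apply: (le_trans (psiK u2)); rewrite -mulrA ler_wpM2l//.
apply: (@le_trans _ _ ((2 * u) ^+ q)).
  by rewrite lerXn2r ?nnegrE; lra.
rewrite exprMn ler_wpM2l ?exprn_ge0// ler_weXn2l//.
Qed.

Let F (y : R) := \int[mu]_(u in `[(1 : R), y]) (v u * f1 u).
Let Phi (y : R) := \int[mu]_(u in `[(1 : R), y]) (v u * f2 u).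

Let vf1_integrable := weighted_integrable weight_measurable decayA cf1 f1K.
Let vf2_integrable := weighted_integrable weight_measurable decayA cf2 f2K.

Let dF (y : R) : 1 < y -> is_derive y 1 F (v y * f1 y).
Proof.
move=> y1; apply: (is_derive_Rintegral y1 vf1_integrable).
by apply: continuousM; [exact: weight_continuous|apply: cf1; lra].
Qed.

Let dPhi (y : R) : 1 < y -> is_derive y 1 Phi (v y * f2 y).
Proof.
move=> y1; apply: (is_derive_Rintegral y1 vf2_integrable).
by apply: continuousM; [exact: weight_continuous|apply: cf2; lra].
Qed.

Let F1 : F 1 = 0. Proof. by rewrite /F set_itv1 Rintegral_set1. Qed.
Let Phi1 : Phi 1 = 0. Proof. by rewrite /Phi set_itv1 Rintegral_set1. Qed.

(** On [1, 2] the product u (omega(u) - A) is 1 - A u, so this piece is integrated explicitly. *)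
Let F2 : F 2 = (1 - 2 * A) * psi 2 - (1 - A) * psi 1 + A * (Psi 2 - Psi 1).
Proof.
pose D (y : R) := (1 - A * y) * psi y + A * Psi y.
have dD (y : R) : 1 <= y -> is_derive y 1 D ((1 - A * y) * dpsi y).
  move=> y1.
  have h1 := is_derive1B (is_derive1_cst 1 y) (is_derive1Z A (is_derive1_id y)).
  have h2 := is_derive1M h1 (dpsiP y1).
  have h3 := is_derive1D h2 (is_derive1Z A (PsiP y1)).
  by refine (is_derive_eq h3 _); ring.
have : F 2 - D 2 = F 1 - D 1.
  apply: (@constant_segment R (fun y => F y - D y)); first lra.
  - move=> y y12; have y1 : 1 < y by lra.
    refine (is_derive_eq (is_derive1B (dF y1) (dD y (ltW y1))) _).
    have [_ om _ _] := omegaP; rewrite om; last lra.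
    by rewrite /f1; field; rewrite gt_eqF; lra.
  - move=> y y12; apply: continuousB; last first.
      by apply: is_derive_continuous (dD y _); lra.
    have [->|yn1] := eqVneq y 1; first exact: continuous_Rintegral1.
    apply: is_derive_continuous (dF _).
    by rewrite lt_neqAle eq_sym yn1; lra.
rewrite F1 /D; lra.
Qed.

(** Formally the integral of (u v) psi' is a boundary term minus the integral of (u v)' psi. Here (u
    v)' is - A on (1, 2), which gives the increment of [Psi], and v(u - 1) beyond 2, which after
    translation by 1 gives psi(u + 1). *)
Lemma shifted_ibp : weighted v f1 =
  - (1 - A) * psi 1 + A * (Psi 2 - Psi 1) - weighted v f2.
Proof.
(* A conserved quantity: its derivative vanishes for y > 2. The argument y - 1 makes [Phi] start
   from 0 at y = 2. *)
pose H (y : R) := F y + Phi (y - 1) - (y * (omega y - A)) * psi y.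
have sub1 (y : R) : is_derive y 1 (fun w : R => w - 1) 1.
  have h := is_derive1B (is_derive1_id y) (is_derive1_cst 1 y).
  by refine (is_derive_eq h _); rewrite subr0.
have H2 (y : R) : 2 <= y -> H y = H 2.
  move=> y2; apply: constant_segment => // [x xy|x xy].
    have x1 : 1 < x by lra.
    have x2 : 2 < x by lra.
    have x11 : 1 < x - 1 by lra.
    have h1 := @is_derive1_comp R Phi (fun w : R => w - 1) x _ _ (dPhi x11) (sub1 x).
    have h2 := is_derive1M (weight_mulr_is_derive x2) (dpsiP (ltW x1)).
    have h3 := is_derive1B (is_derive1D (dF x1) h1) h2.
    refine (is_derive_eq h3 _).
    by rewrite /f1 /f2 subrK; ring.
  apply: continuousB; first apply: continuousD.
  - by apply: is_derive_continuous (dF _); lra.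
  - apply: continuous_comp; first exact: is_derive_continuous (sub1 x).
    have [->|xn2] := eqVneq x 2.
      have -> : 2 - 1 = 1 :> R by ring.
      exact: continuous_Rintegral1.
    have : 2 < x by rewrite lt_neqAle eq_sym xn2; lra.
    by move=> x2; apply: is_derive_continuous (dPhi _); lra.
  - apply: continuousM; last by apply: cpsi; lra.
    by apply: continuousM; [exact: cvg_id|apply: weight_continuous; lra].
have {}H2' : H 2 = - (1 - A) * psi 1 + A * (Psi 2 - Psi 1).
  have [_ om _ _] := omegaP.
  rewrite /H F2 (_ : 2 - 1 = 1) ?Phi1 ?om; [|lra|lra].
  by field.
have [C1 C10 b] := weighted_le_invsq decayA q.+1.
pose L := K * 2 ^+ q.
have f1L : forall u : R, 1 <= u -> `|f1 u| <= L * u ^+ q.+1 by exact: f1K.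
have f2L : forall u : R, 1 <= u -> `|f2 u| <= L * u ^+ q.+1 by exact: f2K.
(* The boundary term and the two truncation errors are O(1/y). The constant 4 is 1 + 2 + 1, the 2
   coming from 1/(y - 1) <= 2/y. *)
have bound : forall y : R, 2 <= y ->
    `|weighted v f1 + weighted v f2 - H 2| <= (L * C1 * 4) / y.
  move=> y y2; rewrite -(H2 y y2).
  have y0 : 0 < y by lra.
  have t1 := @Rintegral_truncate R _ _ y ltac:(lra) (weighted_measurable weight_measurable cf1) (b _ _ f1L).
  have t2 := @Rintegral_truncate R _ _ (y - 1) ltac:(lra) (weighted_measurable weight_measurable cf2) (b _ _ f2L).
  have t3 : `|y * (omega y - A) * psi y| <= L * C1 / y.
    have psiL (u : R) : 1 <= u -> `|psi u| <= L * u ^+ q.+1.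
      move=> u1; apply: (le_trans (psiK u1)); rewrite ler_pM ?exprn_ge0//; first lra.
        by rewrite ler_peMr// exprn_ege1//; lra.
      exact: ler_weXn2l.
    have h := b _ _ psiL y ltac:(lra).
    rewrite -mulrA normrM (gtr0_norm y0).
    apply: (le_trans (ler_wpM2l (ltW y0) h)).
    rewrite le_eqVlt; apply/orP; left; apply/eqP.
    by field; rewrite gt_eqF.
  have L0 : 0 <= L * C1 by rewrite mulr_ge0// mulr_ge0// exprn_ge0.
  have t2' : L * C1 / (y - 1) <= 2 * (L * C1 / y).
    rewrite mulrCA ler_wpM2l// -[leLHS]mul1r ler_pdivrMr; last lra.
    by rewrite mulrAC ler_pdivlMr; lra.
  have := le_trans t2 t2'; move: t1 t3.
  rewrite /weighted -/(F y) -/(Phi (y - 1)) /H.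
  move: (L * C1) => LC.
  rewrite !ler_norml => /andP[? ?] /andP[? ?] /andP[? ?].
  by apply/andP; split; lra.
have := eq0_le_div bound; rewrite H2'; lra.
Qed.

End shifted_ibp.

(** * Approximation of e^(-t) by (1 - t/N)^N, leading to harmonic numbers *)

Section exponential_approximation.
Context {R : realType}.

Lemma bernoulli_le (x : R) (n : nat) : 0 <= x <= 1 -> 1 - n%:R * x <= (1 - x) ^+ n.
Proof.
move=> x01; elim: n => [|n IHn]; first by rewrite mul0r subr0 expr0.
rewrite exprS -natr1.
have h : (1 - x) * (1 - n%:R * x) <= (1 - x) * (1 - x) ^+ n.
  by rewrite ler_wpM2l//; lra.
apply: le_trans h.
have n0 : 0 <= n%:R :> R by rewrite ler0n.
nra.
Qed.

(** For the lower bound, (1 - t/N)^N e^t >= ((1 - t/N)(1 + t/N))^N = (1 - t^2/N^2)^N, to which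
    Bernoulli's inequality applies. *)
Lemma expn_one_sub_bounds (n : nat) (t : R) : 0 <= t <= n.+1%:R ->
  (1 - t ^+ 2 / n.+1%:R) * expR (- t) <= (1 - t / n.+1%:R) ^+ n.+1 <= expR (- t).
Proof.
set N := n.+1%:R => tN.
have N0 : 0 < N by rewrite ltr0n.
have tN01 : 0 <= t / N <= 1.
  by case/andP: tN => ? ?; rewrite ler_pdivrMr// mul1r divr_ge0// ltW.
have powE (x : R) : expR (x / N) ^+ n.+1 = expR x.
  by rewrite -expRM_natl mulrC divfK// gt_eqF.
apply/andP; split; last first.
  rewrite -(powE (- t)) mulNr lerXn2r ?nnegrE ?expR_ge0//.
    by rewrite subr_ge0; case/andP: tN01.
  exact: expR_ge1Dx.
rewrite expRN ler_pdivrMr ?expR_gt0//.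
apply: (@le_trans _ _ ((1 - t / N) ^+ n.+1 * (1 + t / N) ^+ n.+1)); last first.
  rewrite ler_wpM2l ?exprn_ge0 ?subr_ge0//; first by case/andP: tN01.
  rewrite -(powE t) lerXn2r ?nnegrE ?expR_ge0// ?addr_ge0//; first by case/andP: tN01.
  exact: expR_ge1Dx.
rewrite -exprMn (_ : (1 - t / N) * (1 + t / N) = 1 - (t / N) ^+ 2); last by ring.
apply: le_trans (bernoulli_le _ _); last first.
  by case/andP: tN01 => ? ?; rewrite sqr_ge0 expr_le1.
rewrite -/N le_eqVlt; apply/orP; left; apply/eqP.
by field; rewrite gt_eqF.
Qed.

(* Approximates \int_0^t (1 - e^(-y))/y dy by a function whose value at n + 1
   is a harmonic number. *)
Definition harmonic_primitive (n : nat) (t : R) : R :=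
  \sum_(k < n.+1) (1 - (1 - t / n.+1%:R) ^+ k.+1) / k.+1%:R.

Lemma harmonic_primitive0 (n : nat) : harmonic_primitive n 0 = 0.
Proof. by apply: big1 => k _; rewrite mul0r subr0 expr1n subrr mul0r. Qed.

Lemma harmonic_primitiven (n : nat) :
  harmonic_primitive n n.+1%:R = \sum_(1 <= k < n.+2) k%:R^-1.
Proof.
rewrite big_add1 /= big_mkord; apply: eq_bigr => k _.
by rewrite divff ?pnatr_eq0// subrr expr0n/= subr0 mul1r.
Qed.

(** Termwise differentiation leaves a geometric sum of ratio 1 - t/N. *)
Lemma harmonic_primitive_is_derive (n : nat) (t : R) : t != 0 ->
  is_derive t 1 (harmonic_primitive n) ((1 - (1 - t / n.+1%:R) ^+ n.+1) / t).
Proof.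
move=> t0; have [N NE N0] : exists2 N : R, n.+1%:R = N & N != 0.
  by exists n.+1%:R; rewrite ?pnatr_eq0.
rewrite /harmonic_primitive NE.
have h (k : 'I_n.+1) : is_derive t 1
    (fun t => (1 - (1 - t / N) ^+ k.+1) / k.+1%:R) (N^-1 * (1 - t / N) ^+ k).
  have h1 := is_derive1B (is_derive1_cst 1 t) (is_derive1Z N^-1 (is_derive1_id t)).
  have h2 := @is_derive1_comp R (fun y => y ^+ k.+1) _ t _ _ (is_derive_exprn k.+1 _) h1.
  have h3 := is_derive1Z k.+1%:R^-1 (is_derive1B (is_derive1_cst 1 t) h2).
  rewrite (_ : (fun t => _) = (fun y => k.+1%:R^-1 * (1 - (1 - N^-1 * y) ^+ k.+1))).
    refine (is_derive_eq h3 _) => /=.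
    have k0 : k.+1%:R != 0 :> R by rewrite pnatr_eq0.
    rewrite (mulrC N^-1 t); move: (_ ^+ k) => z; move: k0; move: (k.+1%:R) => z' k0.
    by field; rewrite k0 N0.
  by apply/funext => y; rewrite mulrC (mulrC y).
have := is_derive_sum h.
rewrite (_ : \sum_(i < n.+1) _ =
    fun t => \sum_(k < n.+1) (1 - (1 - t / N) ^+ k.+1) / k.+1%:R); last first.
  by apply/funext => y; rewrite fct_sumE.
move=> hs; refine (is_derive_eq hs _).
rewrite -mulr_sumr.
have := subrX1 (1 - t / N) n.+1.
move: (\sum_(i < n.+1) _) => S E.
have -> : 1 - (1 - t / N) ^+ n.+1 = t / N * S by rewrite -opprB E; ring.
by field; rewrite t0 N0.
Qed.

Lemma harmonic_primitive_continuous (n : nat) (t : R) :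
  {for t, continuous (harmonic_primitive n)}.
Proof.
have [->|/harmonic_primitive_is_derive h] := eqVneq t 0; last first.
  exact: is_derive_continuous (h n).
rewrite /harmonic_primitive (_ : (fun t => _) =
   \sum_(k < n.+1) (fun t : R => (1 - (1 - t / n.+1%:R) ^+ k.+1) / k.+1%:R)); last first.
  by apply/funext => y; rewrite fct_sumE.
apply: (big_ind (fun f : R -> R => {for 0, continuous f})).
- exact: cst_continuous.
- by move=> f g cf cg; exact: continuousD.
- move=> k _; apply: continuousM; last exact: cst_continuous.
  apply: continuousB; first exact: cst_continuous.
  apply: (@continuous_comp _ _ _ (fun t : R => 1 - t / n.+1%:R) (fun y => y ^+ k.+1)).
    apply: continuousB; first exact: cst_continuous.
    by apply: continuousM; [exact: cvg_id|exact: cst_continuous].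
  exact: exprn_continuous.
Qed.

End exponential_approximation.

(** * The Laplace transform of [omega] and the value of its limit *)

Section buchstab_laplace.
Context {R : realType} {omega : R -> R} (omegaP : is_buchstab omega).
Context {A : R} (A_gt0 : 0 < A) (decayA : rapid_decay (fun u => omega u - A)).
Local Notation v := (fun u : R => omega u - A).

Let V (t : R) : R := weighted v (fun u => expR (- (t * u))).

Lemma is_derive_expR_scale (k u : R) :
  is_derive u 1 (fun w : R => expR (- (k * w))) (- k * expR (- (k * u))).
Proof.
have h := is_derive1Z (- k) (is_derive1_id u).
have := @is_derive1_comp R expR _ u _ _ (is_derive_expR _) h.
rewrite (_ : expR \o _ = fun w : R => expR (- (k * w))); last first.
  by apply/funext => w /=; rewrite mulNr.
by move=> {}h; refine (is_derive_eq h _); rewrite /= mulr1 mulrC (mulNr k u).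
Qed.

Lemma is_derive_expRN (t : R) : is_derive t 1 (fun w : R => expR (- w)) (- expR (- t)).
Proof.
have := is_derive_expR_scale 1 t.
rewrite (_ : (fun w : R => _) = (fun w : R => expR (- w))).
  by rewrite mul1r mulN1r.
by apply/funext => w; rewrite mul1r.
Qed.

Let kernel_le1 (t u : R) : 0 <= t -> 1 <= u -> `|expR (- (t * u))| <= expR (- t).
Proof.
move=> t0 u1; rewrite ger0_norm ?expR_ge0// ler_expR lerN2.
by rewrite ler_peMr.
Qed.

Let kernel_continuous (t u : R) : {for u, continuous (fun w => expR (- (t * w)))}.
Proof. exact: is_derive_continuous (is_derive_expR_scale t u). Qed.

Let V_is_derive (t : R) : 0 < t ->
  is_derive t 1 V (weighted v (fun u => - u * expR (- (t * u)))).
Proof.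
move=> t0.
have expN (x : R) : 0 < x -> expR (- x) <= 1.
  by move=> x0; rewrite expR_le1; lra.
apply: (@weighted_is_derive R v (weight_measurable omegaP) decayA 1 1 t 0 (t + 1)
   (fun x u => expR (- (x * u))) (fun x u => - u * expR (- (x * u)))).
- by apply/andP; split; lra.
- by move=> x u _ _; exact: kernel_continuous.
- move=> x u /andP[x0 _] u1; rewrite mul1r expr1.
  by rewrite (le_trans (kernel_le1 (ltW x0) u1))// (le_trans (expN _ x0)).
- move=> x u xt u1; have := is_derive_expR_scale u x.
  by under eq_fun do rewrite mulrC; rewrite (mulrC u).
- move=> x u /andP[x0 _] u1; rewrite mul1r expr1 normrM normrN.
  have u0 : 0 <= u by exact: le_trans u1.
  rewrite (ger0_norm u0) ler_piMr//.
  by rewrite (le_trans (kernel_le1 (ltW x0) u1))// expN.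
Qed.

(** This is [shifted_ibp] for psi(u) = e^(-tu): u psi'(u) is t times the integrand of V', and psi(u
    + 1) = e^(-t) psi(u). *)
Let V_equation (t : R) : 0 < t ->
  t * weighted v (fun u => - u * expR (- (t * u))) =
  - (1 - A) * expR (- t) + A * (expR (- t) - expR (- (t * 2))) / t
  - expR (- t) * V t.
Proof.
move=> t0.
pose psi (u : R) := expR (- (t * u)).
pose dpsi (u : R) := - t * expR (- (t * u)).
pose Psi (u : R) := - t^-1 * expR (- (t * u)).
have tn0 : t != 0 by rewrite gt_eqF.
have et1 : expR (- t) <= 1 by rewrite expR_le1; lra.
have psi1 (u : R) : 1 <= u -> `|psi u| <= 1.
  by move=> u1; apply: le_trans (kernel_le1 (ltW t0) u1) et1.
have d1 (u : R) : 1 <= u -> is_derive u 1 psi (dpsi u).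
  by move=> _; exact: is_derive_expR_scale.
have d2 (u : R) : 1 <= u -> is_derive u 1 Psi (psi u).
  move=> _; refine (is_derive_eq (is_derive1Z _ (is_derive_expR_scale t u)) _).
  by rewrite /psi; field.
have c1 (u : R) : 1 <= u -> {for u, continuous dpsi}.
  move=> _; apply: continuousM; first exact: cst_continuous.
  exact: kernel_continuous.
have b1 (u : R) : 1 <= u -> `|psi u| <= (1 + t) * u ^+ 0.
  by move=> u1; rewrite expr0 mulr1 (le_trans (psi1 _ u1))//; lra.
have b2 (u : R) : 1 <= u -> `|dpsi u| <= (1 + t) * u ^+ 0.
  move=> u1; rewrite expr0 mulr1 /dpsi normrM normrN (gtr0_norm t0).
  have := psi1 u u1; rewrite /psi => h.
  by apply: (@le_trans _ _ t); [rewrite ler_piMr// ltW|lra].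
have := shifted_ibp omegaP decayA d1 d2 c1 b1 b2.
set W1 := weighted _ _; set W2 := weighted _ _ => E.
have W1E : W1 = t * weighted v (fun u => - u * expR (- (t * u))).
  rewrite -(@weightedZ R v (weight_measurable omegaP) decayA 1 t 1).
  - by apply: eq_weighted => u _; rewrite /dpsi; ring.
  - move=> u _; apply: continuousM; last exact: kernel_continuous.
    by apply: continuousN; exact: cvg_id.
  - move=> u u1; rewrite mul1r expr1 normrM normrN.
    have u0 : 0 <= u by exact: le_trans u1.
    by rewrite (ger0_norm u0) ler_piMr// psi1.
have W2E : W2 = expR (- t) * V t.
  rewrite -(@weightedZ R v (weight_measurable omegaP) decayA 1 _ 0).
  - by apply: eq_weighted => u _; rewrite /psi -expRD; congr expR; ring.
  - by move=> u _; exact: kernel_continuous.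
  - by move=> u u1; rewrite mulr1; exact: psi1.
rewrite -W1E E W2E /psi /Psi mulr1; field.
exact: tn0.
Qed.

(* For t > 0 this is t * (1 + \int_1^oo omega u e^(-ut) du). *)
Let G (t : R) : R := if t <= 0 then A else t + A * expR (- t) + t * V t.

Let G_is_derive (t : R) : 0 < t -> is_derive t 1 G ((1 - expR (- t)) / t * G t).
Proof.
move=> t0.
have tn0 : t != 0 by rewrite gt_eqF.
have h1 := is_derive1D (is_derive1_id t) (is_derive1Z A (is_derive_expRN t)).
have h2 := is_derive1D h1 (is_derive1M (is_derive1_id t) (V_is_derive t0)).
refine (near_eq_is_derive _ (is_derive_eq h2 _)).
  near=> w; rewrite /G leNgt.
  suff -> : 0 < w by [].
  by near: w; exact: lt_nbhsr.
rewrite V_equation// /G leNgt t0/=.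
rewrite (_ : expR (- (t * 2)) = expR (- t) * expR (- t)); last first.
  by rewrite -expRD; congr expR; ring.
by field.
Unshelve. all: by end_near. Qed.

(** V stays bounded as t decreases to 0, so the value A chosen for t <= 0 makes G continuous and
    supplies the initial condition. *)
Let G_near0 : exists2 C : R, 0 < C & forall t : R, 0 <= t -> `|G t - A| <= C * t.
Proof.
have A0 := A_gt0.
have [C C0 h] := weighted_le (weight_measurable omegaP) decayA 0.
exists (1 + A + C) => [|t t0]; first lra.
rewrite /G; case: ifPn => t0'.
  by rewrite subrr normr0 mulr_ge0//; lra.
have {}t0 : 0 < t by rewrite ltNge.
have hV : `|V t| <= 1 * C.
  apply: h => u u1; first exact: kernel_continuous.
  rewrite mulr1; apply: le_trans (kernel_le1 (ltW t0) u1) _.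
  by rewrite expR_le1; lra.
have e1 := expR_ge1Dx (- t).
have e2 : expR (- t) <= 1 by rewrite expR_le1; lra.
rewrite mul1r ler_norml in hV; case/andP: hV => v1 v2.
rewrite ler_norml; apply/andP; split; nra.
Qed.

Let G_continuous (t : R) : 0 <= t -> {for t, continuous G}.
Proof.
rewrite le_eqVlt => /predU1P[<-|t0]; last exact: is_derive_continuous (G_is_derive t0).
have [C C0 h] := G_near0.
have G0 : G 0 = A by rewrite /G lexx.
rewrite /prop_for /continuous_at; apply/cvgrPdist_le => e e0; near=> w.
rewrite G0 distrC; have [w0|w0] := leP w 0.
  by rewrite /G w0 subrr normr0 ltW.
apply: le_trans (h _ (ltW w0)) _.
rewrite mulrC -ler_pdivlMr//; apply: ltW; near: w; apply: lt_nbhsl.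
by rewrite divr_gt0.
Unshelve. all: by end_near. Qed.

(** The sign of G is not known in advance, hence the square: (G^2)' = 2 G^2 (1 - e^(-t))/t >= 0
    keeps G away from 0, so that ln(G^2) can be differentiated. *)
Let G_ge (t : R) : 0 <= t -> A ^+ 2 <= G t ^+ 2.
Proof.
move=> t0.
have G0 : G 0 = A by rewrite /G lexx.
have dG (x : R) : 0 < x < t -> is_derive x 1 (fun y => G y * G y)
    (2 * ((1 - expR (- x)) / x * (G x * G x))).
  move=> /andP[x0 _].
  by refine (is_derive_eq (is_derive1M (G_is_derive x0) (G_is_derive x0)) _); ring.
rewrite -G0 !expr2; apply: (derive_ge0_le t0 dG).
- move=> x /andP[x0 _]; have := @continuousM _ _ _ _ x (G_continuous x0) (G_continuous x0).
  exact.
- move=> x /andP[x0 _]; rewrite mulr_ge0// mulr_ge0//; last by rewrite -expr2 sqr_ge0.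
  by rewrite divr_ge0 ?(ltW x0)// subr_ge0 expR_le1 oppr_le0 ltW.
Qed.

Let L (t : R) : R := ln (G t ^+ 2).

Let L_is_derive (t : R) : 0 < t -> is_derive t 1 L (2 * ((1 - expR (- t)) / t)).
Proof.
move=> t0.
have G2 : 0 < G t * G t by rewrite -expr2 (lt_le_trans _ (G_ge (ltW t0)))// exprn_gt0.
have h := is_derive1M (G_is_derive t0) (G_is_derive t0).
have := @is_derive1_comp R (@ln R) _ t _ _ (is_derive1_ln G2) h.
move=> {}h; refine (is_derive_eq h _).
have : G t != 0 by apply: contraTneq G2 => ->; rewrite mul0r ltxx.
by move=> ?; field; rewrite gt_eqF.
Qed.

Let L_continuous (t : R) : 0 <= t -> {for t, continuous L}.
Proof.
move=> t0; have G2 : 0 < G t ^+ 2.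
  by rewrite (lt_le_trans _ (G_ge t0))// exprn_gt0.
apply: (@continuous_comp _ _ _ (fun t => G t ^+ 2) (@ln R)); last exact: continuous_ln.
apply: (@continuous_comp _ _ _ G (fun y => y ^+ 2)); first exact: G_continuous.
exact: exprn_continuous.
Qed.

Let L_continuous_in (N t : R) : 0 <= t <= N -> {for t, continuous L}.
Proof. by move=> /andP[t0 _]; exact: L_continuous. Qed.

Let L_is_derive_in (N t : R) : 0 < t < N ->
  is_derive t 1 L (2 * ((1 - expR (- t)) / t)).
Proof. by move=> /andP[t0 _]; exact: L_is_derive. Qed.

Let P (n : nat) (t : R) := 2 * harmonic_primitive n t.

Let P_is_derive (n : nat) (t : R) : 0 < t < n.+1%:R ->
  is_derive t 1 (P n) (2 * ((1 - (1 - t / n.+1%:R) ^+ n.+1) / t)).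
Proof.
move=> /andP[t0 _].
by apply: is_derive1Z; apply: harmonic_primitive_is_derive; rewrite gt_eqF.
Qed.

Let P_continuous (n : nat) (t : R) : 0 <= t <= n.+1%:R -> {for t, continuous (P n)}.
Proof.
move=> _; apply: continuousM; first exact: cst_continuous.
exact: harmonic_primitive_continuous.
Qed.

Let L_le_P (n : nat) : L n.+1%:R - L 0 <= P n n.+1%:R - P n 0.
Proof.
apply: (derive_le (ler0n _ _) (@L_is_derive_in _) (@P_is_derive n)
  (@L_continuous_in _) (@P_continuous n)) => t /andP[t0 tN].
have /expn_one_sub_bounds/andP[_ h] : 0 <= t <= n.+1%:R by rewrite !ltW.
by rewrite ler_pM2l// ler_pM2r ?invr_gt0// lerB.
Qed.

(** A primitive of (2/N) t e^(-t) with N = n + 1, the excess of P' over L' permitted by the lower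
    bound for (1 - t/N)^N. *)
Let q (n : nat) (t : R) := - 2 / n.+1%:R * ((1 + t) * expR (- t)).

Let q_is_derive (n : nat) (t : R) :
  is_derive t 1 (q n) (2 / n.+1%:R * (t * expR (- t))).
Proof.
have h := is_derive1Z (- 2 / n.+1%:R)
  (is_derive1M (is_derive1D (is_derive1_cst 1 t) (is_derive1_id t)) (is_derive_expRN t)).
by refine (is_derive_eq h _); ring.
Qed.

Let P_le_L (n : nat) : P n n.+1%:R - P n 0 <=
  (L n.+1%:R + q n n.+1%:R) - (L 0 + q n 0).
Proof.
apply: (derive_le (g := fun t => L t + q n t) (ler0n _ _) (@P_is_derive n)
  (fun t tN => is_derive1D (L_is_derive_in tN) (q_is_derive n t)) (@P_continuous n)).
  move=> t tN; apply: continuousD; first exact: L_continuous_in tN.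
  exact: is_derive_continuous (q_is_derive n t).
move=> t /andP[t0 tN].
have /expn_one_sub_bounds/andP[h _] : 0 <= t <= n.+1%:R by rewrite !ltW.
apply: (@le_trans _ _ (2 * ((1 - (1 - t ^+ 2 / n.+1%:R) * expR (- t)) / t))).
  by rewrite ler_pM2l// ler_pM2r ?invr_gt0// lerB.
have tn0 : t != 0 by rewrite gt_eqF.
have : n.+1%:R != 0 :> R by rewrite pnatr_eq0.
move: (n.+1%:R) (expR _) => N e N0; rewrite le_eqVlt; apply/orP; left; apply/eqP.
by field; rewrite tn0 N0.
Qed.

Let q_le (n : nat) : q n n.+1%:R - q n 0 <= 2 / n.+1%:R.
Proof.
have -> : q n n.+1%:R - q n 0 =
    2 / n.+1%:R - 2 / n.+1%:R * ((1 + n.+1%:R) * expR (- n.+1%:R)).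
  by rewrite /q oppr0 expR0; ring.
by rewrite lerBlDr lerDl mulr_ge0 ?divr_ge0// mulr_ge0 ?expR_ge0// addr_ge0.
Qed.

Let L_harmonic (n : nat) :
  0 <= (\sum_(1 <= k < n.+2) k%:R^-1) - (L n.+1%:R - L 0) / 2 <= n.+1%:R^-1.
Proof.
move: (L_le_P n) (P_le_L n) (q_le n).
rewrite /P harmonic_primitive0 harmonic_primitiven mulr0 subr0.
move: (L _) (L 0) (q n _) (q n 0) (\sum_(_ <= _ < _) _) (n.+1%:R^-1) => a b c d s e.
lra.
Qed.

(** The harmonic number H_N equals (L N - L 0)/2 up to 1/N. Since L 0 = 2 ln A, and G(N)/N -> 1
    gives L N = 2 ln N + o(1), the difference H_N - ln N tends to - ln A. *)
Lemma buchstab_limit_euler : A = expR (- euler_gamma R).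
Proof.

suff -> : euler_gamma R = - ln A by rewrite opprK lnK.
have A0 := A_gt0.
have [C C0 h] := weighted_le (weight_measurable omegaP) decayA 0.
pose r (n : nat) := G n.+1%:R / n.+1%:R.
have rle (n : nat) : `|r n - 1| <= (A + C) / n.+1%:R.
  have [N NE N1] : exists2 N : R, n.+1%:R = N & 1 <= N by exists n.+1%:R; rewrite ?ler1n.
  have N0' : 0 < N by lra.
  have GE : G N = N + A * expR (- N) + N * V N by rewrite /G leNgt N0'.
  have N0 : N != 0 by rewrite gt_eqF.
  rewrite /r NE GE.
  have -> : (N + A * expR (- N) + N * V N) / N - 1 = A * expR (- N) / N + V N by field.
  have hV : `|V N| <= expR (- N) * C.
    apply: h => u u1; first exact: kernel_continuous.
    by rewrite mulr1; apply: kernel_le1 => //; lra.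
  have e1 : expR (- N) <= N^-1.
    rewrite expRN lef_pV2 ?posrE ?expR_gt0//.
    by apply: le_trans (expR_ge1Dx N); rewrite lerDr.
  have e0 := expR_ge0 (- N).
  apply: (le_trans (ler_normD _ _)).
  rewrite mulrDl lerD//; last first.
    by apply: le_trans hV _; rewrite mulrC ler_wpM2l.
  rewrite ger0_norm; last by rewrite !mulr_ge0 ?invr_ge0//; lra.
  rewrite -mulrA ler_wpM2l//; first lra.
  by rewrite ler_piMl ?invr_ge0//; [lra|rewrite expR_le1; lra].
have inv0 : (A + C) / n.+1%:R @[n --> \oo] --> 0.
  rewrite -(mulr0 (A + C)); apply: cvgM; first exact: cvg_cst.
  exact: cvg_harmonic.
have r1 : r n @[n --> \oo] --> (1 : R).
  apply/subr_cvg0; apply: norm_cvg0.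
  apply: (squeeze_cvgr _ _ inv0); last exact: cvg_cst.
  by near=> n; rewrite normr_ge0 rle.
have r2 : r n ^+ 2 @[n --> \oo] --> (1 : R).
  have -> : (fun n => r n ^+ 2) = r * r by apply/funext => n; rewrite expr2.
  by rewrite -[X in _ --> X](mulr1 1); exact: cvgM.
have lr : ln (r n ^+ 2) @[n --> \oo] --> 0.
  by rewrite -(@ln1 R); apply: continuous_cvg r2; exact: continuous_ln.
have H n : ln (r n ^+ 2) / 2 - ln A <=
    (\sum_(1 <= k < n.+2) k%:R^-1) - ln n.+1%:R <=
    ln (r n ^+ 2) / 2 - ln A + n.+1%:R^-1.
  have := L_harmonic n.
  have -> : L 0 = ln A * 2.
    by rewrite /L (_ : G 0 = A) ?lnXn ?mulr_natr// /G lexx.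
  have -> : L n.+1%:R = ln (r n ^+ 2) + ln n.+1%:R * 2.
    have G2 : 0 < G n.+1%:R ^+ 2 by rewrite (lt_le_trans _ (G_ge _))// exprn_gt0.
    have n2 : ln (n.+1%:R ^+ 2) = ln n.+1%:R * 2 :> R by rewrite lnXn// mulr_natr.
    have N2 : 0 < n.+1%:R ^+ 2 :> R by rewrite exprn_gt0.
    have E : ln (r n ^+ 2) = ln (G n.+1%:R ^+ 2) - ln (n.+1%:R ^+ 2).
      by rewrite /r expr_div_n; apply: ln_div; rewrite posrE.
    by rewrite E n2 subrK.
  move: (ln A) (ln n.+1%:R) (ln (r n ^+ 2)) (\sum_(_ <= _ < _) _) (n.+1%:R^-1) => a b c d e.
  lra.
rewrite /euler_gamma; apply: cvg_lim => //; rewrite -cvg_shiftS/=.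
have lr2 : ln (r n ^+ 2) / 2 - ln A @[n --> \oo] --> - ln A.
  rewrite -[X in _ --> X]add0r; apply: cvgB; last exact: cvg_cst.
  by rewrite -(mul0r (2^-1)); apply: cvgM => //; exact: cvg_cst.
apply: (squeeze_cvgr _ lr2).
  by near=> n; exact: H.
rewrite -[X in _ --> X]addr0; apply: cvgD; first exact: lr2.
exact: cvg_harmonic.
Unshelve. all: by end_near. Qed.

End buchstab_laplace.

(** * Quadratic moments of the exponential series *)

Section exponential_moments.
Context {R : realType}.

(** In the basis 1, k, k (k - 1) each factor cancels against k! and shifts the exponential series by
    one or two places. *)
Lemma exp_partial_moments (T b0 b1 b2 : R) (K : nat) :
  \sum_(k < K.+2) T ^+ k / k`!%:R * (b0 + b1 * k%:R + b2 * (k%:R * (k%:R - 1))) =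
  b0 * series (exp_coeff T) K.+2 + b1 * T * series (exp_coeff T) K.+1 +
  b2 * T ^+ 2 * series (exp_coeff T) K.
Proof.
pose e (n : nat) := series (exp_coeff T) n.
have eS (n : nat) : e n.+1 = e n + T ^+ n / n`!%:R.
  by rewrite /e /series/= big_nat_recr.
have e0 : e 0 = 0 by rewrite /e /series/= big_geq.
rewrite -!/(e _); elim: K => [|K IHK].
  rewrite !eS e0 !big_ord_recr !big_ord0/= !fact0 !expr0 !expr1 /= ?factS ?fact0.
  by field.
rewrite big_ord_recr/= IHK (eS K.+2) (eS K.+1) (eS K).
move: (e K) => E.
rewrite !factS !natrM !exprS -!natr1.
have K0 : K`!%:R != 0 :> R by rewrite pnatr_eq0 -lt0n fact_gt0.
have K1 : K%:R + 1 != 0 :> R by rewrite natr1 pnatr_eq0.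
have K2 : K%:R + 1 + 1 != 0 :> R by rewrite !natr1 pnatr_eq0.
move: K0 K1 K2; set k := K%:R; set F := K`!%:R => K0 K1 K2.
by field; rewrite K0 K1 K2.
Qed.

Lemma exp_moments_le (T b0 b1 b2 C : R) (K0 : nat) :
  (forall K : nat, (K0 <= K)%N ->
    \sum_(k < K.+2) T ^+ k / k`!%:R * (b0 + b1 * k%:R + b2 * (k%:R * (k%:R - 1))) <= C) ->
  expR T * (b0 + b1 * T + b2 * T ^+ 2) <= C.
Proof.
move=> h.
have cE : series (exp_coeff T) @ \oo --> expR T by exact: is_cvg_series_exp_coeff.
have cS (m : nat) : series (exp_coeff T) (n + m)%N @[n --> \oo] --> expR T.
  by rewrite cvg_shiftn.
have c : b0 * series (exp_coeff T) (n + 2)%N + b1 * T * series (exp_coeff T) (n + 1)%N +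
  b2 * T ^+ 2 * series (exp_coeff T) n @[n --> \oo] -->
  b0 * expR T + b1 * T * expR T + b2 * T ^+ 2 * expR T.
  apply: cvgD; first apply: cvgD.
  - by apply: cvgM; [exact: cvg_cst|exact: cS].
  - by apply: cvgM; [exact: cvg_cst|exact: cS].
  - by apply: cvgM; [exact: cvg_cst|exact: cE].
have -> : expR T * (b0 + b1 * T + b2 * T ^+ 2) =
    b0 * expR T + b1 * T * expR T + b2 * T ^+ 2 * expR T by ring.
rewrite -(cvg_lim (@Rhausdorff R) c).
apply: limr_le; first by apply/cvg_ex; eexists; exact: c.
exists K0 => // n /= Kn.
by rewrite addn2 addn1 -exp_partial_moments; exact: h.
Qed.

End exponential_moments.

(* [f n] are the Taylor coefficients of exp (x t - \int_0^t (e^y - 1)/y dy).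
   Near the saddle point T = ln x they cannot all stay positive past
   n = x (ln x - 1): testing the recurrence against the weights
   T^n B(n - M), with B a concave parabola positive exactly at the integers
   1, ..., H, gives a sum of nonnegative terms. *)
Section positivity_breaks.
Context {R : realType} (x T : R) (f : nat -> R) (M H : nat).
Hypothesis T0 : 0 < T.
Hypothesis xT : expR T = x.
Hypothesis frec : forall n : nat,
  n.+1%:R * f n.+1 = x * f n - \sum_(m < n.+1) f m / (n.+1 - m)`!%:R.
Hypothesis start_ge : x * T ^+ 2 <= (2 * H%:R + 1) / 4 * (x * T - x + 1).
Hypothesis H1 : (0 < H)%N.
Hypothesis middle_ge : forall y : R, M%:R <= y ->
  x * T ^+ 2 <= (H%:R / 2 - 4^-1) * (y + x - x * T).

Let B (y : R) : R := (y - 2^-1) * (H%:R + 2^-1 - y).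
Let w (n : nat) : R := T ^+ n * Num.max 0 (B (n%:R - M%:R)).
Let P := (M + H)%N.
(** The coefficient of f m after multiplying the recurrence for n f n by w n and summing over n. *)
Let S (m : nat) : R := m%:R * w m - x * w m.+1 +
  \sum_(m.+1 <= n < P.+1) w n / (n - m)`!%:R.

Let B_le0 (n : nat) : (n <= M)%N || (P < n)%N -> B (n%:R - M%:R) <= 0.
Proof.
rewrite /B => /orP[nM|Pn].
  have : n%:R <= M%:R :> R by rewrite ler_nat.
  have : 0 <= H%:R :> R by [].
  by move=> *; nra.
have : M%:R + H%:R + 1 <= n%:R :> R by rewrite -natrD natr1 ler_nat.
have : 0 <= H%:R :> R by [].
by move=> *; nra.
Qed.

(** On [1, H] the concave parabola is smallest at the ends, where B(1) = B(H) = H/2 - 1/4. *)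
Let B_ge (n : nat) : (M < n <= P)%N -> H%:R / 2 - 4^-1 <= B (n%:R - M%:R).
Proof.
rewrite /B => /andP[Mn nP].
have a : M%:R + 1 <= n%:R :> R by rewrite natr1 ler_nat.
have b : n%:R <= M%:R + H%:R :> R by rewrite -natrD ler_nat.
nra.
Qed.

Let w_ge0 (n : nat) : 0 <= w n.
Proof. by rewrite mulr_ge0 ?exprn_ge0 ?le_max ?lexx// ltW. Qed.

Let w_eq0 (n : nat) : (n <= M)%N || (P < n)%N -> w n = 0.
Proof. by move=> /B_le0 h; rewrite /w (max_idPl h) mulr0. Qed.

Let w_mid (n : nat) : (M < n <= P)%N -> w n = T ^+ n * B (n%:R - M%:R).
Proof.
move=> /B_ge h; rewrite /w (max_idPr _)//; apply: le_trans h.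
have : 1 <= H%:R :> R by rewrite ler1n.
lra.
Qed.

Let w_ge (n : nat) : T ^+ n * B (n%:R - M%:R) <= w n.
Proof.
have T0' := T0.
by rewrite /w ler_wpM2l ?exprn_ge0 ?le_max ?lexx ?orbT// ltW. Qed.

(** The weights dominate T^n B(n - M) even where B is negative, so the finite tail dominates the
    whole series over k >= 1 of T^(m+k) B(j + k)/k!. As B(j + k) = B(j) + (H - 2j) k - k (k - 1),
    that series is a quadratic moment, with e^T = x. *)
Let tail_ge (m : nat) (j : R) : j = m%:R - M%:R ->
  T ^+ m * (x * (B j + (H%:R - 2 * j) * T - T ^+ 2) - B j) <=
  \sum_(m.+1 <= n < P.+1) w n / (n - m)`!%:R.
Proof.
move=> jE; have Tm : 0 < T ^+ m by rewrite exprn_gt0.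
rewrite -ler_pdivlMl//.
set tl := \sum_(_ <= n < _) _.
suff : expR T * (B j + (H%:R - 2 * j) * T + (-1) * T ^+ 2) <= B j + (T ^+ m)^-1 * tl.
  by rewrite xT mulN1r; lra.
apply: (@exp_moments_le R T _ _ _ _ P) => K PK.
rewrite -(ler_pM2l Tm) (mulrDr _ (B j)) (mulrA _ _^-1) divff ?gt_eqF// mul1r mulr_sumr.
rewrite big_ord_recl/= expr0 fact0 divr1 mul1r mulr0 mul0r !mulr0 !addr0.
rewrite lerD2l.
apply: (@le_trans _ _ (\sum_(k < K.+1) w (m + k.+1) / k.+1`!%:R)).
  apply: ler_sum => k _; rewrite /bump/= add1n.
  have k0 : 0 < (k.+1`!%:R)^-1 :> R by rewrite invr_gt0 ltr0n fact_gt0.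
  apply: le_trans (ler_wpM2r (ltW k0) (w_ge (m + k.+1))).
  rewrite le_eqVlt; apply/orP; left; apply/eqP.
  by rewrite exprD natrD /B jE; field; rewrite gt_eqF// -invr_gt0.
rewrite -(big_mkord xpredT (fun k => w (m + k.+1) / k.+1`!%:R)).
have -> : \sum_(0 <= k < K.+1) w (m + k.+1) / k.+1`!%:R =
    \sum_(m.+1 <= n < m + K.+2) w n / (n - m)`!%:R.
  rewrite -[m.+1]add0n big_addn; have -> : (m + K.+2 - m.+1 = K.+1)%N by lia.
  apply: eq_big_nat => k _; have -> : (k + m.+1 = m + k.+1)%N by lia.
  by rewrite addKn.
have [mP|Pm] := leqP m P.
  rewrite (@big_cat_nat _ _ _ P.+1)//=; last by lia.
  rewrite [X in _ + X <= _]big_nat_cond [X in _ + X <= _]big1 ?addr0//.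
  move=> n /andP[/andP[Pn _] _]; by rewrite w_eq0 ?mul0r// Pn orbT.
rewrite big_nat_cond big1; last first.
  move=> n /andP[/andP[mn _] _]; by rewrite w_eq0 ?mul0r//; apply/orP; right; lia.
by apply: sumr_ge0 => n _; rewrite divr_ge0.
Qed.

(** Outside M <= m < P the negative term vanishes. For M < m < P the terms in H - 2j cancel thanks
    to e^T = x, leaving B(j)(m - 1 + x - x T) >= x T^2, a case of [middle_ge]. At m = M the weight
    is 0 while B(0) = -(2H + 1)/4, and [start_ge] is what remains. *)
Let S_ge0 (m : nat) : 0 <= S m.
Proof.
have T0' := T0.
have x0 : 0 < x by rewrite -xT expR_gt0.
have tl0 : 0 <= \sum_(m.+1 <= n < P.+1) w n / (n - m)`!%:R.
  by apply: sumr_ge0 => n _; rewrite divr_ge0.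
have [Mm|mM] := leqP M m; last first.
  rewrite /S [w m.+1]w_eq0; last by rewrite mM.
  by rewrite mulr0 subr0 addr_ge0// mulr_ge0.
have [Pm|mP] := ltnP P m.+1.
  rewrite /S [w m.+1]w_eq0; last by rewrite Pm orbT.
  by rewrite mulr0 subr0 addr_ge0// mulr_ge0.
have := tail_ge (erefl (m%:R - M%:R)); rewrite /S.
move: (\sum_(_ <= n < _) _) tl0 => tl tl0.
rewrite [w m.+1]w_mid; last by rewrite ltnS Mm.
rewrite (exprS T m) -(natr1 m).
have Tm : 0 < T ^+ m by rewrite exprn_gt0.
move: Mm; rewrite leq_eqVlt => /predU1P[ME|Mm].
  rewrite -ME subrr (_ : M%:R + 1 - M%:R = 1); last by ring.
  rewrite [w M]w_eq0 ?leqnn// /B.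
  move=> h; have h2 := ler_wpM2l (ltW Tm) start_ge.
  rewrite -ME in h2; move: (T ^+ M) h h2 => Y h h2; lra.
rewrite w_mid; last by rewrite Mm; lia.
have Bm : H%:R / 2 - 4^-1 <= B (m%:R - M%:R) by apply: B_ge; rewrite Mm; lia.
have Mm1 : M%:R <= m%:R - 1 :> R by rewrite lerBrDr natr1 ler_nat.
have h := middle_ge Mm1.
have H1' : 1 <= H%:R :> R by rewrite ler1n.
have d0 : 0 <= m%:R - 1 + x - x * T.
  have q0 : 0 < H%:R / 2 - 4^-1 :> R by lra.
  rewrite -(pmulr_rge0 _ q0); apply: le_trans h.
  by rewrite mulr_ge0 ?sqr_ge0// ltW.
have h2 : x * T ^+ 2 <= B (m%:R - M%:R) * (m%:R - 1 + x - x * T).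
  by apply: le_trans h _; rewrite ler_wpM2r.
have h3 := ler_wpM2l (ltW Tm) h2.
have E : B (m%:R + 1 - M%:R) = B (m%:R - M%:R) + H%:R - 2 * (m%:R - M%:R).
  by rewrite /B; field.
rewrite E; move: (B _) (T ^+ m) h3 => b Y h3 h4; lra.
Qed.

Lemma positivity_breaks : exists2 n : nat, (n <= M + H)%N & f n <= 0.
Proof.
apply: contrapT => hn.
have fpos (n : nat) : (n <= P)%N -> 0 < f n.
  by move=> nP; rewrite ltNge; apply/negP => fn; apply: hn; exists n.
have T0' := T0.
have P0 : (0 < P)%N by rewrite addn_gt0 H1 orbT.
have SP : 0 < S P.
  rewrite /S [w P.+1]w_eq0 ?ltnSn ?orbT// mulr0 subr0 big_geq// addr0.
  have MP : (M < P <= P)%N by rewrite leqnn andbT -[X in (X < _)%N]addn0 ltn_add2l.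
  rewrite mulr_gt0 ?ltr0n// w_mid// mulr_gt0 ?exprn_gt0//.
  apply: lt_le_trans (B_ge MP).
  by have : 1 <= H%:R :> R by [rewrite ler1n]; lra.
have pos : 0 < \sum_(m < P.+1) f m * S m.
  rewrite big_ord_recr/= ltr_wpDl// ?mulr_gt0 ?fpos//.
  apply: sumr_ge0 => m _; rewrite mulr_ge0// ltW// fpos//.
  by rewrite ltnW// ltn_ord.
suff E : \sum_(m < P.+1) f m * S m = 0 by rewrite E ltxx in pos.
have split_sum : \sum_(m < P.+1) f m * S m =
  \sum_(m < P.+1) m%:R * w m * f m - \sum_(m < P.+1) x * w m.+1 * f m +
  \sum_(m < P.+1) \sum_(n < P.+1 | (m < n)%N) w n * (f m / (n - m)`!%:R).
  rewrite -sumrB -big_split/=; apply: eq_bigr => m _.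
  rewrite /S big_geq_mkord/= mulrDr mulr_sumr; congr (_ + _); first by ring.
  by apply: eq_bigr => n _; ring.
rewrite split_sum.
(* Interchanging the sums collects, for each n, w n times the recurrence, which is zero. *)
have -> : \sum_(m < P.+1) \sum_(n < P.+1 | (m < n)%N) w n * (f m / (n - m)`!%:R) =
    \sum_(n < P.+1) w n * \sum_(m < n) f m / (n - m)`!%:R.
  under eq_bigr do rewrite big_mkcond.
  rewrite exchange_big/=; apply: eq_bigr => n _.
  rewrite -big_mkcond mulr_sumr.
  rewrite (big_ord_widen P.+1 (fun m => w n * (f m / (n - m)`!%:R)))//.
  exact: ltnW.
rewrite big_ord_recl/= mul0r mul0r add0r.
rewrite [X in _ - X]big_ord_recr/= (@w_eq0 P.+1) ?ltnSn ?orbT// mulr0 mul0r addr0.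
rewrite [X in _ + X]big_ord_recl/= big_ord0 mulr0 add0r.
rewrite -sumrB -big_split/=; apply: big1 => n _.
have := frec n; rewrite /bump/= add1n.
move: (\sum_(m < n.+1) _) => s E; have -> : s = x * f n - n.+1%:R * f n.+1 by rewrite E; ring.
ring.
Qed.

End positivity_breaks.

(** Each F n is a polynomial on [x, oo), hence no remainder: inductively the two sides have the same
    derivative in h and agree at h = 0. *)
Lemma appell_taylor (R : realType) (F : nat -> R -> R) (x h : R) : 0 <= h ->
  (forall y : R, x <= y -> is_derive y 1 (F 0) 0) ->
  (forall (n : nat) (y : R), x <= y -> is_derive y 1 (F n.+1) (F n y)) ->
  forall n, F n (x + h) = \sum_(k < n.+1) F (n - k)%N x * (h ^+ k / k`!%:R).
Proof.
move=> h0 F0 FS n.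
pose S (n : nat) (h : R) := \sum_(k < n.+1) F (n - k)%N x * (h ^+ k / k`!%:R).
have S0 (m : nat) : S m 0 = F m x.
  rewrite /S big_ord_recl/= expr0 fact0 divr1 mulr1 subn0 big1 ?addr0// => k _.
  by rewrite /bump/= add1n expr0n/= mul0r mulr0.
have dterm (c : R) (k : nat) (w : R) :
    is_derive w 1 (fun w : R => c * (w ^+ k / k`!%:R)) (c * (k%:R * w ^+ k.-1 / k`!%:R)).
  have := is_derive1Z c (is_derive1Z (k`!%:R)^-1 (is_derive_exprn k w)).
  rewrite (_ : (fun y : R => _) = (fun w : R => c * (w ^+ k / k`!%:R))).
    by move=> hd; refine (is_derive_eq hd _); rewrite [_^-1 * _]mulrC.
  by apply/funext => y; rewrite [_^-1 * _]mulrC.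
have dS (m : nat) (w : R) : is_derive w 1 (S m.+1) (S m w).
  have := is_derive_sum (fun k : 'I_m.+2 => dterm (F (m.+1 - k)%N x) k w).
  rewrite (_ : \sum_(k < m.+2) (fun w : R => _) = S m.+1); last first.
    by apply/funext => y; rewrite fct_sumE.
  move=> hd; refine (is_derive_eq hd _).
  rewrite big_ord_recl/= !mul0r mulr0 add0r; apply: eq_bigr => k _.
  rewrite /bump/= add1n subSS factS natrM; congr (_ * _).
  have k0 : k.+1%:R != 0 :> R by rewrite pnatr_eq0.
  have f0 : k`!%:R != 0 :> R by rewrite pnatr_eq0 -lt0n fact_gt0.
  move: k0 f0; move: (k.+1%:R) (k`!%:R) => a b a0 b0.
  by field; rewrite a0 b0.
have dshift (w : R) : is_derive w 1 (fun w : R => x + w) 1.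
  have hd := is_derive1D (is_derive1_cst x w) (is_derive1_id w).
  by refine (is_derive_eq hd _); rewrite add0r.
have comp (G : R -> R) (g w : R) : is_derive (x + w) 1 G g ->
    is_derive w 1 (fun w => G (x + w)) g.
  move=> hg; have hd := @is_derive1_comp R G (fun w : R => x + w) w _ _ hg (dshift w).
  by refine (is_derive_eq hd _); rewrite mulr1.
rewrite -/(S n h); elim: n h h0 => [|n IHn] h h0.
  rewrite /S big_ord_recl big_ord0/= subn0 expr0 fact0 divr1 mulr1 addr0.
  have d0 (w : R) : 0 <= w -> is_derive w 1 (fun w => F 0 (x + w)) 0.
    by move=> w0; apply: comp; apply: F0; rewrite lerDl.
  have := @constant_segment R (fun w => F 0 (x + w)) 0 h h0.
  rewrite addr0; apply.
    by move=> w /andP[w0 _]; apply: d0; exact: ltW.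
  by move=> w /andP[w0 _]; exact: is_derive_continuous (d0 w w0).
have d0 (w : R) : 0 <= w -> is_derive w 1 (fun w => F n.+1 (x + w) - S n.+1 w) 0.
  move=> w0; have xw : x <= x + w by rewrite lerDl.
  have hd := is_derive1B (comp _ _ _ (FS n _ xw)) (dS n w).
  by refine (is_derive_eq hd _); rewrite IHn// subrr.
have := @constant_segment R (fun w => F n.+1 (x + w) - S n.+1 w) 0 h h0.
rewrite addr0 S0 subrr => E; apply/eqP; rewrite -subr_eq0; apply/eqP; apply: E.
  by move=> w /andP[w0 _]; apply: d0; exact: ltW.
by move=> w /andP[w0 _]; exact: is_derive_continuous (d0 w w0).
Qed.

(* If positivity or the bound q' < T q failed somewhere on [x0, +oo[, let s be
   the last such point: beyond s we have q' < T q, so q s > 0 and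
   q (s + 1) <= e^T q s, and the equation forces q' < T q at s as well. *)
Lemma positive_above (R : realType) (q dq : R -> R) (l T x0 X C : R) :
  0 < x0 -> 0 < T ->
  (forall x : R, 0 < x -> is_derive x 1 q (dq x)) ->
  (forall x : R, 0 < x -> x * dq x = (l - 1) * q x + q (x + 1)) ->
  (forall x : R, X <= x -> 0 < q x /\ q (x + 1) <= C * q x) ->
  l - 1 + expR T < x0 * T ->
  forall x : R, x0 <= x -> 0 < q x.
Proof.
move=> x00 T0 dqP eqn large lT x x0x.
pose good (y : R) := 0 < q y /\ dq y < T * q y.
suff : good x by case.
apply: contrapT => badx.
pose E := [set y : R | x0 <= y /\ ~ good y].
have Ex : E x by [].
have cq (y : R) : 0 < y -> {for y, continuous q}.
  by move=> y0; exact: is_derive_continuous (dqP y y0).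
(* Beyond Y the equation and q(y + 1) <= C q(y) give y q' <= (l - 1 + C) q < T y q. *)
pose Y := Num.max x0 (Num.max X ((`|l - 1| + `|C| + 1) / T)).
have Yge : [/\ x0 <= Y, X <= Y & (`|l - 1| + `|C| + 1) / T <= Y].
  by rewrite /Y !le_max !lexx !orbT.
have goodY (y : R) : Y <= y -> good y.
  case: Yge => Y1 Y2 Y3 Yy; have y0 : 0 < y by lra.
  have [qy qy1] := large y (le_trans Y2 Yy); split => //.
  rewrite -(ltr_pM2l y0) eqn//.
  have h : `|l - 1| + `|C| + 1 <= y * T by rewrite -ler_pdivrMr// (le_trans Y3).
  have h1 := ler_norm (l - 1); have h2 := ler_norm C.
  apply: (@le_lt_trans _ _ ((l - 1 + C) * q y)); first by rewrite [leRHS]mulrDl lerD2l.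
  rewrite mulrA ltr_pM2r//; lra.
have ubE : ubound E Y.
  move=> y [_ bady]; rewrite leNgt; apply/negP => Yy; apply: bady.
  by apply: goodY; exact: ltW.
have hsE : has_sup E by split; [exists x|exists Y].
pose s := sup E.
have x0s : x0 <= s by apply: le_trans x0x _; apply: ub_le_sup => //; exists Y.
have s0 : 0 < s by exact: lt_le_trans x0s.
have goods (y : R) : s < y -> good y.
  move=> sy; apply: contrapT => bady; have : y <= s.
    apply: ub_le_sup; first by exists Y.
    by split => //; lra.
  lra.
pose r (y : R) := - (q y * expR (- T * y)).
have dr (y : R) : 0 < y ->
    is_derive y 1 r (- (dq y * expR (- T * y) - T * q y * expR (- T * y))).
  move=> y0.
  have he := @is_derive1_comp R expR _ y _ _ (is_derive_expR _) (is_derive1Z (- T) (is_derive1_id y)).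
  have hd := is_derive1Z (-1) (is_derive1M (dqP y y0) he).
  rewrite (_ : r = fun y => -1 * (q y * (expR \o (fun y => - T * y)) y)).
    by refine (is_derive_eq hd _) => /=; ring.
  by apply/funext => z /=; rewrite mulN1r.
have r_le (y : R) : s <= y -> r s <= r y.
  move=> sy; apply: (derive_ge0_le sy (df := fun y => - (dq y * expR (- T * y) - T * q y * expR (- T * y)))).
  - by move=> z /andP[sz _]; apply: dr; exact: lt_trans sz.
  - by move=> z /andP[sz _]; apply: is_derive_continuous (dr z _); exact: lt_le_trans sz.
  - move=> z /andP[sz _]; rewrite -mulrBl oppr_ge0 pmulr_lle0 ?expR_gt0//.
    by have [_ h] := goods z sz; lra.
have key (h : R) : 0 <= h -> q (s + h) <= expR (T * h) * q s.
  move=> h0; have := r_le (s + h); rewrite lerDl => /(_ h0); rewrite /r.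
  have -> : expR (- T * (s + h)) = expR (- T * s) * (expR (T * h))^-1.
    by rewrite -expRN -expRD; congr expR; ring.
  rewrite lerN2 mulrCA [leRHS]mulrC ler_pM2l ?expR_gt0//.
  by rewrite ler_pdivrMr ?expR_gt0// mulrC.
have qs : 0 < q s.
  have [h _] := goods (s + 1) ltac:(lra).
  have := lt_le_trans h (key 1 ler01).
  by rewrite pmulr_rgt0 ?expR_gt0.
have dqE (y : R) : 0 < y -> dq y = y^-1 * ((l - 1) * q y + q (y + 1)).
  by move=> y0; rewrite -eqn// mulrA mulVf ?mul1r// gt_eqF.
have dqs : dq s < T * q s.
  rewrite -(ltr_pM2l s0) eqn//.
  have := key 1 ler01; rewrite mulr1 => k1.
  apply: (@le_lt_trans _ _ ((l - 1 + expR T) * q s)); first by rewrite [leRHS]mulrDl lerD2l.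
  rewrite mulrA ltr_pM2r//; apply: lt_le_trans lT _.
  by rewrite ler_wpM2r// ltW.
(* Continuity of [dq] is not assumed, but the equation writes T q - q' as the continuous function k.
   Its positivity at s persists to the left of s, which contradicts the choice of s as a supremum of
   bad points. *)
pose k (y : R) := T * q y - y^-1 * ((l - 1) * q y + q (y + 1)).
have ck : {for s, continuous k}.
  apply: continuousB.
    by apply: continuousM; [exact: cst_continuous|exact: cq].
  apply: continuousM; first by apply: continuousV; [rewrite gt_eqF|exact: cvg_id].
  apply: continuousD.
    by apply: continuousM; [exact: cst_continuous|exact: cq].
  apply: (@continuous_comp _ _ _ (fun y : R => y + 1) q).
    by apply: continuousD; [exact: cvg_id|exact: cst_continuous].
  by apply: cq; lra.
have ks : 0 < k s by rewrite /k -dqE// subr_gt0.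
have near_good : \forall y \near s, 0 < y /\ good y.
  near=> y.
  have y0 : 0 < y by near: y; exact: lt_nbhsr.
  split => //; split; first by near: y; apply: (cvgr_gt (q s)) => //; exact: cq.
  rewrite dqE// -subr_gt0 -/(k y).
  by near: y; apply: (cvgr_gt (k s)).
have [e /= e0 he] := near_good.
have [y Ey sy] := sup_adherent e0 hsE.
have ys : y <= s by apply: ub_le_sup => //; exists Y.
case: Ey => x0y bady; apply: bady.
suff : 0 < y /\ good y by case.
by apply: he; rewrite /= ger0_norm ?subr_ge0//; rewrite -/s in sy; lra.
Unshelve. all: by end_near. Qed.

(** * Powers of x + u as functions of u, of x and of the exponent *)

Section shifted_powers.
Context {R : realType}.

Lemma powR_shift_le (x r mu u : R) (q : nat) : mu <= q%:R -> 0 <= x <= r ->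
  1 <= u -> (x + u) `^ mu <= (1 + r) ^+ q * u ^+ q.
Proof.
move=> muq xr u1; have xu1 : 1 <= x + u by lra.
apply: (le_trans (ler_powR xu1 muq)); rewrite powR_mulrn; last lra.
rewrite -exprMn lerXn2r ?nnegrE//; first lra.
  by apply: mulr_ge0; lra.
by nra.
Qed.

Lemma nat_bound (mu : R) : exists q : nat, `|mu| + 2 <= q%:R.
Proof.
exists (Num.bound (`|mu| + 2)).
by rewrite ltW// archi_boundP// addr_ge0.
Qed.

Lemma powR_shift_is_derive (mu x u : R) : 0 < x + u ->
  is_derive u 1 (fun w : R => (x + w) `^ mu) (mu * (x + u) `^ (mu - 1)).
Proof.
move=> xu; have h := is_derive1D (is_derive1_cst x u) (is_derive1_id u).
have hd := @is_derive1_comp R (fun y => y `^ mu) _ u _ _ (is_derive1_powR mu xu) h.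
by refine (is_derive_eq hd _); rewrite add0r mulr1.
Qed.

Lemma powR_shiftl_is_derive (mu x u : R) : 0 < x + u ->
  is_derive x 1 (fun w : R => (w + u) `^ mu) (mu * (x + u) `^ (mu - 1)).
Proof.
move=> xu; have h := is_derive1D (is_derive1_id x) (is_derive1_cst u x).
have hd := @is_derive1_comp R (fun y => y `^ mu) _ x _ _ (is_derive1_powR mu xu) h.
by refine (is_derive_eq hd _); rewrite addr0 mulr1.
Qed.

Lemma powR_exponent_is_derive (y mu : R) : 0 < y ->
  is_derive mu 1 (fun m : R => y `^ m) (ln y * y `^ mu).
Proof.
move=> y0; have h := is_derive1Z (ln y) (is_derive1_id mu).
have hd := @is_derive1_comp R expR _ mu _ _ (is_derive_expR _) h.
rewrite (_ : (fun m : R => _) = expR \o (fun m => ln y * m)).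
  by refine (is_derive_eq hd _); rewrite /= mulr1 /powR gt_eqF// mulrC (mulrC mu).
by apply/funext => m /=; rewrite /powR gt_eqF// mulrC.
Qed.

Lemma powR_shift_continuous (mu x u : R) : 0 < x + u ->
  {for u, continuous (fun w : R => (x + w) `^ mu)}.
Proof. by move=> xu; exact: is_derive_continuous (powR_shift_is_derive mu xu). Qed.

Lemma powR_succ (y mu : R) : 0 < y -> y * y `^ (mu - 1) = y `^ mu.
Proof.
move=> y0; rewrite -{1}(powRr1 (ltW y0)) -powRD; last by rewrite (gt_eqF y0) implybT.
by congr (_ `^ _); ring.
Qed.

End shifted_powers.

(** * The adjoint solution, its functional relations and its growth *)

Section buchstab_adjoint.
Context {R : realType} {omega : R -> R} (omegaP : is_buchstab omega).
Context {A : R} (A_gt0 : 0 < A) (decayA : rapid_decay (fun u => omega u - A)).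
Local Notation v := (fun u : R => omega u - A).
Local Notation mv := (weight_measurable (A := A) omegaP).

Let K (x mu : R) : R := weighted v (fun u => (x + u) `^ mu).

(** The margin up to mu + 2 leaves room for ln(x + u) <= x + u, met when differentiating in the
    exponent. *)
Let kernel_bound (x mu : R) : 0 <= x -> exists q : nat, exists2 C : R, 0 <= C &
  forall y m u : R, 0 <= y <= x + 1 -> m <= mu + 2 -> 1 <= u ->
    `|(y + u) `^ m| <= C * u ^+ q.
Proof.
move=> x0; have [q qmu] := nat_bound mu; exists q.
exists ((1 + (x + 1)) ^+ q); first by rewrite exprn_ge0//; lra.
move=> y m u yx mmu u1; rewrite ger0_norm ?powR_ge0//.
apply: powR_shift_le => //; apply: le_trans mmu _; apply: le_trans qmu.
by rewrite lerD2r ler_norm.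
Qed.

Let K_is_derive (x mu : R) : 0 < x ->
  is_derive x 1 (fun y => K y mu) (mu * K x (mu - 1)).
Proof.
move=> x0; have [q [C C0 hC]] := kernel_bound mu (ltW x0).
have mu1 : mu <= mu + 2 by lra.
have mu2 : mu - 1 <= mu + 2 by lra.
have n1 := normr_ge0 mu.
rewrite -(weightedZ (K := C) (q := q) mv decayA mu); last 2 first.
- by move=> u u1; apply: powR_shift_continuous; lra.
- by move=> u u1; apply: hC => //; lra.
apply: (@weighted_is_derive R v mv decayA ((1 + `|mu|) * C) q x 0 (x + 1)
  (fun y u => (y + u) `^ mu) (fun y u => mu * (y + u) `^ (mu - 1))).
- lra.
- by move=> y u yx u1; apply: powR_shift_continuous; lra.
- move=> y u yx u1; have yx' : 0 <= y <= x + 1 by lra.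
  apply: le_trans (hC _ _ _ yx' mu1 u1) _.
  rewrite ler_wpM2r ?exprn_ge0//; first lra.
  by rewrite ler_peMl//; lra.
- by move=> y u yx u1; apply: powR_shiftl_is_derive; lra.
- move=> y u yx u1; have yx' : 0 <= y <= x + 1 by lra.
  rewrite normrM -mulrA ler_pM//; first by lra.
  exact: hC yx' mu2 u1.
Qed.

Let K_continuous (x mu : R) : 0 < x -> {for mu, continuous (K x)}.
Proof.
move=> x0; have [q [C C0 hC]] := kernel_bound mu (ltW x0).
have xx : 0 <= x <= x + 1 by lra.
apply: is_derive_continuous (weighted v (fun u => ln (x + u) * (x + u) `^ mu)) _.
apply: (@weighted_is_derive R v mv decayA C q mu (mu - 1) (mu + 1)
  (fun m u => (x + u) `^ m) (fun m u => ln (x + u) * (x + u) `^ m)).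
- lra.
- by move=> m u mmu u1; apply: powR_shift_continuous; lra.
- by move=> m u mmu u1; apply: hC => //; lra.
- by move=> m u mmu u1; apply: powR_exponent_is_derive; lra.
- move=> m u mmu u1; have mmu' : m + 1 <= mu + 2 by lra.
  apply: le_trans (hC _ _ _ xx mmu' u1).
  have xu : 0 < x + u by lra.
  rewrite normrM -(powR_succ (m + 1) xu) (_ : m + 1 - 1 = m); last by ring.
  rewrite normrM ler_wpM2r// !ger0_norm ?(ltW xu) ?ln_ge0//; last lra.
  exact: ltW (ln_sublinear xu).
Qed.

(** This is [shifted_ibp] for psi(u) = (x + u)^(l - 1), with u = (x + u) - x in u psi'(u). The
    primitive (x + u)^l / l is why l must be nonzero. *)
Let K_ibp (x l : R) : 0 < x -> l != 0 ->
  (l - 1) * K x (l - 1) - x * ((l - 1) * K x (l - 1 - 1)) =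
  - (1 - A) * (x + 1) `^ (l - 1) + A * ((x + 1 + 1) `^ l - (x + 1) `^ l) / l -
  K (x + 1) (l - 1).
Proof.
move=> x0 l0; set mu := l - 1.
have [q [C C0 hC]] := kernel_bound mu (ltW x0).
have xx : 0 <= x <= x + 1 by lra.
have mu1 : mu <= mu + 2 by lra.
have mu2 : mu - 1 <= mu + 2 by lra.
have n1 := normr_ge0 mu.
pose D := (1 + `|mu|) * C.
pose psi (u : R) := (x + u) `^ mu.
pose dpsi (u : R) := mu * (x + u) `^ (mu - 1).
pose Psi (u : R) := l^-1 * (x + u) `^ l.
have d1 (u : R) : 1 <= u -> is_derive u 1 psi (dpsi u).
  by move=> u1; apply: powR_shift_is_derive; lra.
have d2 (u : R) : 1 <= u -> is_derive u 1 Psi (psi u).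
  move=> u1; have xu : 0 < x + u by lra.
  refine (is_derive_eq (is_derive1Z _ (powR_shift_is_derive l xu)) _).
  by rewrite mulrA mulVf// mul1r.
have c1 (u : R) : 1 <= u -> {for u, continuous dpsi}.
  move=> u1; apply: continuousM; first exact: cst_continuous.
  by apply: powR_shift_continuous; lra.
have c0 (u : R) : 1 <= u -> {for u, continuous psi}.
  by move=> u1; apply: powR_shift_continuous; lra.
have b1 (u : R) : 1 <= u -> `|psi u| <= D * u ^+ q.
  move=> u1; apply: le_trans (hC _ _ _ xx mu1 u1) _.
  rewrite ler_wpM2r ?exprn_ge0//; first lra.
  by rewrite ler_peMl//; lra.
have b2 (u : R) : 1 <= u -> `|dpsi u| <= D * u ^+ q.
  move=> u1; rewrite normrM -mulrA ler_pM//; first by lra.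
  exact: hC xx mu2 u1.
have mC := mulr_ge0 n1 C0.
have xC := mulr_ge0 (ltW x0) C0.
have xmC := mulr_ge0 (ltW x0) mC.
have hD : `|mu| * C <= (1 + x) * D by rewrite /D; clear -C0 mC xC xmC; lra.
have hxD : x * `|mu| * C <= (1 + x) * D by rewrite /D; clear -C0 mC xC xmC; lra.
have := shifted_ibp omegaP decayA d1 d2 c1 b1 b2.
have -> : weighted v (fun u => u * dpsi u) = mu * K x mu - x * (mu * K x (mu - 1)).
  have cm2 (u : R) : 1 <= u -> {for u, continuous (fun w : R => (x + w) `^ (mu - 1))}.
    by move=> u1; apply: powR_shift_continuous; lra.
  have bm2 (u : R) : 1 <= u -> `|(x + u) `^ (mu - 1)| <= C * u ^+ q.
    by move=> u1; exact: hC xx mu2 u1.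
  have bm1 (u : R) : 1 <= u -> `|(x + u) `^ mu| <= C * u ^+ q.
    by move=> u1; exact: hC xx mu1 u1.
  have e1 : mu * K x mu = weighted v (fun u => mu * (x + u) `^ mu).
    by rewrite (weightedZ mv decayA mu c0 bm1).
  have e2 : x * (mu * K x (mu - 1)) = - weighted v (fun u => - (x * mu) * (x + u) `^ (mu - 1)).
    by rewrite (weightedZ mv decayA _ cm2 bm2) -/(K x (mu - 1)); ring.
  rewrite e1 e2 opprK -(@weightedD R v mv decayA ((1 + x) * D) q).
  - apply: eq_weighted => u u1; have xu : 0 < x + u by lra.
    by rewrite /dpsi -(powR_succ mu xu); move: (_ `^ _) => p; ring.
  - by move=> u u1; apply: continuousM; [exact: cst_continuous|exact: c0].
  - move=> u u1; rewrite normrM.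
    have uq : 0 <= u ^+ q by rewrite exprn_ge0// (le_trans ler01 u1).
    apply: (le_trans (ler_wpM2l n1 (bm1 u u1))).
    by rewrite mulrA ler_wpM2r.
  - by move=> u u1; apply: continuousM; [exact: cst_continuous|exact: cm2].
  - move=> u u1; rewrite normrM normrN normrM (gtr0_norm x0).
    have uq : 0 <= u ^+ q by rewrite exprn_ge0// (le_trans ler01 u1).
    have xmu : 0 <= x * `|mu| by rewrite mulr_ge0// ltW.
    apply: (le_trans (ler_wpM2l xmu (bm2 u u1))).
    by rewrite mulrA ler_wpM2r.
have -> : weighted v (fun u => psi (u + 1)) = K (x + 1) mu.
  by apply: eq_weighted => u _; rewrite /psi; congr (_ `^ _); ring.
move=> ->; rewrite /psi /Psi (_ : x + 2 = x + 1 + 1); last by ring.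
by field.
Qed.

(* [g (1/x) (-l)] times [x^(l - 1) / A], see [g_buchstab_adjoint]; with this
   normalization it is the solution of the adjoint of the Buchstab equation
   that is equivalent to [x^l] at infinity. *)
Definition buchstab_adjoint (x l : R) : R :=
  (x + 1) `^ l - l / A * (x `^ (l - 1) + K x (l - 1)).
Local Notation Q := buchstab_adjoint.

Lemma buchstab_adjoint0 (x : R) : Q x 0 = 1.
Proof. by rewrite /Q powRr0 !mul0r subr0. Qed.

Lemma buchstab_adjoint_is_derive (x l : R) : 0 < x ->
  is_derive x 1 (fun y => Q y l) (l * Q x (l - 1)).
Proof.
move=> x0; have x1 : 0 < x + 1 by lra.
have h := is_derive1B (powR_shiftl_is_derive l x1)
  (is_derive1Z (l / A) (is_derive1D (is_derive1_powR (l - 1) x0) (K_is_derive (l - 1) x0))).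
by refine (is_derive_eq h _); rewrite /Q; ring.
Qed.

(** For l != 0, solve [K_ibp] for K (x + 1) (l - 1): its boundary terms match the explicit powers in
    Q. At l = 0, Q is 1. *)
Lemma buchstab_adjoint_equation (x l : R) : 0 < x ->
  x * (l * Q x (l - 1)) = (l - 1) * Q x l + Q (x + 1) l.
Proof.
move=> x0; have [->|l0] := eqVneq l 0.
  by rewrite !buchstab_adjoint0 mul0r mulr0; ring.
have x1 : 0 < x + 1 by lra.
have A0 : A != 0 by rewrite gt_eqF.
have := K_ibp x0 l0; rewrite /Q.
rewrite -(powR_succ (l - 1) x0) -(powR_succ l x1).
move: ((x + 1) `^ (l - 1)) (x `^ (l - 1 - 1)) ((x + 1 + 1) `^ l) => m1 xm p2.
move: (K x (l - 1 - 1)) (K x (l - 1)) (K (x + 1) (l - 1)) => k2 k1 k0 E.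
have -> : k0 = - (1 - A) * m1 + A * (p2 - (x + 1) * m1) / l -
  ((l - 1) * k1 - x * ((l - 1) * k2)) by rewrite E; ring.
by field; rewrite A0 l0.
Qed.

Lemma buchstab_adjoint_continuous (x l : R) : 0 < x -> {for l, continuous (Q x)}.
Proof.
move=> x0; have x1 : 0 < x + 1 by lra.
have cpow (y m : R) : 0 < y -> {for m, continuous (fun w : R => y `^ w)}.
  by move=> y0; exact: is_derive_continuous (powR_exponent_is_derive m y0).
have csub : {for l, continuous (fun m : R => m - 1)}.
  by apply: continuousB; [exact: cvg_id|exact: cst_continuous].
apply: continuousB; first exact: cpow.
apply: continuousM.
  by apply: continuousM; [exact: cvg_id|exact: cst_continuous].
apply: continuousD.
  by apply: (@continuous_comp _ _ _ (fun m : R => m - 1) (fun w => x `^ w)) => //; exact: cpow.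
apply: (@continuous_comp _ _ _ (fun m : R => m - 1) (K x)) => //.
exact: K_continuous.
Qed.

Lemma buchstab_adjoint_large (l : R) : exists X C : R, forall x : R, X <= x ->
  0 < Q x l /\ Q (x + 1) l <= C * Q x l.
Proof.
have A0 := A_gt0.
have [q ql] := nat_bound l.
have [M M0 hM] := weighted_le mv decayA q.
(* On [1, 2] this bounds both y^l and y^(-l), whatever the sign of l. *)
pose B : R := 2 ^+ q.
have B1 : 1 <= B by rewrite exprn_ege1//; lra.
have low y : 1 <= y -> 0 < y `^ l by move=> y1; rewrite powR_gt0//; lra.
have qle : l <= q%:R by have := ler_norm l; lra.
have qleN : - l <= q%:R by have := ler_norm (- l); rewrite normrN; lra.
have up (y : R) : 1 <= y <= 2 -> (y `^ l <= B) /\ B^-1 <= y `^ l.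
  move=> y12; have y1 : 1 <= y by lra.
  have hB : y `^ q%:R <= B.
    by rewrite powR_mulrn ?lerXn2r ?nnegrE//; lra.
  split; first by apply: le_trans hB; exact: ler_powR.
  rewrite -[l]opprK powRN lef_pV2 ?posrE ?powR_gt0//; [|lra|lra].
  by apply: le_trans hB; exact: ler_powR.
have shift (x : R) : 1 <= x -> (x + 1) `^ l = x `^ l * (1 + x^-1) `^ l.
  move=> x1; rewrite -powRM; [|lra|by rewrite addr_ge0// invr_ge0; lra].
  by congr (_ `^ _); field; rewrite gt_eqF//; lra.
have inv01 (x : R) : 1 <= x -> 0 < x^-1 <= 1.
  by move=> x1; rewrite invr_gt0 invf_le1; lra.
have Kx (x : R) : 1 <= x -> `|K x (l - 1)| <= x `^ (l - 1) * B * M.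
  move=> x1; apply: hM => u u1; first by apply: powR_shift_continuous; lra.
  rewrite ger0_norm ?powR_ge0//.
  have -> : x + u = x * (u / x + 1) by field; rewrite gt_eqF//; lra.
  have ux : 0 <= u / x <= u.
    have := inv01 x x1 => h.
    by apply/andP; split; [apply: mulr_ge0; lra|rewrite ler_piMr//; lra].
  rewrite powRM; [|lra|lra].
  rewrite -mulrA ler_wpM2l ?powR_ge0//.
  apply: (@le_trans _ _ ((u / x + 1) `^ q%:R)).
    by apply: ler_powR; lra.
  rewrite powR_mulrn; last lra.
  by rewrite /B -exprMn lerXn2r ?nnegrE; lra.
pose c : R := `|l| / A * (1 + B * M).
have c0 : 0 <= c by rewrite mulr_ge0 ?divr_ge0// ?addr_ge0 ?mulr_ge0// ltW//; lra.
have Qx (x : R) : 1 <= x -> `|Q x l - (x + 1) `^ l| <= c * x^-1 * x `^ l.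
  move=> x1; have x0 : 0 < x by lra.
  have -> : Q x l - (x + 1) `^ l = - (l / A) * (x `^ (l - 1) + K x (l - 1)).
    by rewrite /Q; ring.
  rewrite normrM normrN normrM normfV (gtr0_norm A0).
  have E : x `^ (l - 1) = x^-1 * x `^ l.
    by rewrite -(powR_succ l x0) mulKf// gt_eqF.
  have h : `|x `^ (l - 1) + K x (l - 1)| <= (1 + B * M) * (x^-1 * x `^ l).
    apply: (le_trans (ler_normD _ _)); rewrite -E (ger0_norm (powR_ge0 _ _)).
    by rewrite mulrDl mul1r lerD2l (le_trans (Kx x x1))// -mulrA mulrC.
  rewrite /c -!mulrA; apply: ler_wpM2l; first exact: normr_ge0.
  by apply: ler_wpM2l => //; rewrite invr_ge0 ltW.
(* For x >= 2 B c the error c x^(l - 1) is at most half the lower bound x^l / B of the main term.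
   The second constant is the quotient of B (B + c) x^l by x^l / (2 B). *)
exists (Num.max 1 (2 * B * c)), (2 * B * (B * (B + c))) => x.
rewrite ge_max => /andP[x1 xBc].
have x0 : 0 < x by lra.
have /andP[i0 i1] := inv01 x x1.
have B0 : 0 < B by lra.
have y0 := low x x1.
have xx1 : 1 <= x + 1 by lra.
have /andP[j0 j1] := inv01 (x + 1) xx1.
have [z1 z2] := up (1 + x^-1) ltac:(lra).
have [z1' _] := up (1 + (x + 1)^-1) ltac:(lra).
have cx : c * x^-1 <= B^-1 / 2.
  have Bi : 0 <= B^-1 / 2 by rewrite divr_ge0// invr_ge0 ltW.
  rewrite ler_pdivrMr//; apply: le_trans (ler_wpM2l Bi xBc).
  rewrite le_eqVlt; apply/orP; left; apply/eqP.
  by field; rewrite gt_eqF.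
have Q1 := Qx x x1; have Q2 := Qx (x + 1) xx1.
have zy : (x + 1) `^ l <= B * x `^ l.
  by rewrite shift// mulrC ler_wpM2r// ltW.
have zy' : B^-1 * x `^ l <= (x + 1) `^ l.
  by rewrite shift// [leRHS]mulrC ler_wpM2r// ltW.
have zz : (x + 1 + 1) `^ l <= B * (x + 1) `^ l.
  by rewrite shift// mulrC ler_wpM2r// ltW// low.
have cxy : c * x^-1 * x `^ l <= B^-1 / 2 * x `^ l by rewrite ler_wpM2r// ltW.
have z0 := low (x + 1) xx1.
have cz : c * (x + 1)^-1 * (x + 1) `^ l <= c * (x + 1) `^ l.
  by rewrite ler_wpM2r ?(ltW z0)// ler_piMr.
have Qlow : B^-1 / 2 * x `^ l <= Q x l.
  by move: Q1; rewrite ler_norml => /andP[h _]; lra.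
have Bi0 : 0 < B^-1 by rewrite invr_gt0.
split; first by apply: lt_le_trans Qlow; rewrite mulr_gt0// divr_gt0.
have Qup : Q (x + 1) l <= (B + c) * (B * x `^ l).
  move: Q2; rewrite ler_norml => /andP[_ h].
  have Bc0 : 0 <= B + c by rewrite addr_ge0// ltW.
  apply: le_trans (ler_wpM2l Bc0 zy).
  move: h zz cz; move: (Q _ _) (_ `^ l) (_ `^ l) (c / _ * _) => q0 p1 p2 cp h zz cz.
  clear -h zz cz; lra.
apply: le_trans Qup _.
have Bc : 0 <= 2 * B * (B * (B + c)).
  have B0' := ltW B0; have Bc0 : 0 <= B + c by rewrite addr_ge0.
  by do ![apply: mulr_ge0 => //].
apply: le_trans (ler_wpM2l Bc Qlow).
rewrite le_eqVlt; apply/orP; left; apply/eqP.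
by field; rewrite gt_eqF.
Qed.

(** With x = 1/a one has 1 + a u = (x + u)/x, so every term of g is a power of x times a term of Q
    at l = - s. *)
Lemma g_buchstab_adjoint (a s : R) : A = expR (- euler_gamma R) -> 0 < a ->
  g omega a s = A * a^-1 `^ (1 + s) * Q a^-1 (- s).
Proof.
move=> AE a0; rewrite /g -AE; set x := a^-1.
have x0 : 0 < x by rewrite invr_gt0.
have ax : a = x^-1 by rewrite invrK.
have [q [C C0 hC]] := kernel_bound (- s - 1) (ltW x0).
have -> : \int[@lebesgue_measure R]_(u in `[1, +oo[) ((omega u - A) / (1 + a * u) `^ (s + 1)) =
    x `^ (s + 1) * K x (- s - 1).
  rewrite -(weightedZ (K := C) (q := q) mv decayA (x `^ (s + 1))).
  - apply: eq_Rintegral => u; rewrite inE/= in_itv/= andbT => u1.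
    have -> : 1 + a * u = a * (x + u) by rewrite /x; field; rewrite gt_eqF.
    rewrite powRM; [|exact: ltW|lra].
    rewrite invfM -!powRN ax -powR_inv1 ?(ltW x0)// -powRrM.
    by congr (_ * (_ `^ _ * _ `^ _)); ring.
  - by move=> u u1; apply: powR_shift_continuous; lra.
  - by move=> u u1; apply: hC => //; lra.
have E1 : x `^ (1 + s) = x * x `^ s by rewrite -(powR_succ (1 + s) x0); congr (_ * _ `^ _); ring.
have E2 : (x + 1) `^ (- s) = x `^ (- s) * ((1 + a) `^ s)^-1.
  have -> : x + 1 = x * (1 + a) by rewrite ax; field; rewrite gt_eqF.
  by rewrite powRM ?powRN//; lra.
have E3 : x `^ (- s - 1) = x^-1 * x `^ (- s).
  by rewrite -(powR_succ (- s) x0) mulKf// gt_eqF.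
have E4 : x `^ (- s) = (x `^ s)^-1 by rewrite powRN.
have xs : x `^ s != 0 by rewrite gt_eqF// powR_gt0.
have as0 : (1 + a) `^ s != 0 by rewrite gt_eqF// powR_gt0; lra.
rewrite /Q E2 E3 E4 (addrC s 1) E1 ax.
move: xs as0; rewrite ax; move: (x `^ s) ((1 + x^-1) `^ s) (K x _) => xs b k xs0 b0.
have xn : x != 0 by rewrite gt_eqF.
have An : A != 0 by rewrite gt_eqF.
by field; rewrite xs0 b0 xn An.
Qed.

(** The Taylor formula with step 1 expands Q(x + 1, n + 1) in the equation; its leading term f (n +
    1) joins n f (n + 1) to produce the factor n + 1. *)
Lemma buchstab_adjoint_coeff_rec (x : R) : 0 < x -> let f n := Q x n%:R / n`!%:R in
  forall n : nat, n.+1%:R * f n.+1 = x * f n - \sum_(m < n.+1) f m / (n.+1 - m)`!%:R.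
Proof.
move=> x0 f n; pose F (n : nat) (y : R) := Q y n%:R / n`!%:R.
have nE (m : nat) : m.+1%:R - 1 = m%:R :> R by rewrite -natr1 addrK.
have fn0 (m : nat) : m`!%:R != 0 :> R by rewrite pnatr_eq0 -lt0n fact_gt0.
have F0 (y : R) : x <= y -> is_derive y 1 (F 0) 0.
  move=> _; rewrite /F fact0 (_ : (fun y : R => _) = fun=> 1); first exact: is_derive1_cst.
  by apply/funext => z; rewrite buchstab_adjoint0 divr1.
have FS (m : nat) (y : R) : x <= y -> is_derive y 1 (F m.+1) (F m y).
  move=> xy; have y0 : 0 < y by exact: lt_le_trans xy.
  have := is_derive1Z (m.+1)`!%:R^-1 (buchstab_adjoint_is_derive m.+1%:R y0).
  rewrite (_ : (fun y : R => _) = F m.+1); last by apply/funext => z; rewrite mulrC.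
  move=> h; refine (is_derive_eq h _); rewrite nE /F factS natrM.
  have m0 : m.+1%:R != 0 :> R by rewrite pnatr_eq0.
  by move: (fn0 m); move: (m.+1%:R) m0 => b b0 c0; field; rewrite b0 c0.
have := appell_taylor ler01 F0 FS n.+1.
rewrite (reindex_inj rev_ord_inj)/=.
under eq_bigr => k _.
  have -> : (n.+1 - (n.+2 - k.+1) = k)%N by have := ltn_ord k; lia.
  rewrite expr1n mul1r subSS -/(f k); over.
rewrite big_ord_recr/= subnn fact0 divr1 => E.
have := buchstab_adjoint_equation n.+1%:R x0; rewrite nE => E2.
have -> : \sum_(m < n.+1) f m / (n.+1 - m)`!%:R = F n.+1 (x + 1) - f n.+1 by rewrite E addrK.
rewrite /F /f factS natrM.
have n0 : n.+1%:R != 0 :> R by rewrite pnatr_eq0.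
have -> : Q (x + 1) n.+1%:R = x * (n.+1%:R * Q x n%:R) - n%:R * Q x n.+1%:R.
  move: E2; move: (Q (x + 1) _) (x * _) (n%:R * _) => q2 q3 q4 ->.
  by rewrite addrAC subrr add0r.
rewrite -(nE n).
move: (fn0 n); move: (n.+1%:R) n0 (Q x _) (Q x _) => b b0 q1 q2 c0.
by field; rewrite b0 c0.
Qed.

End buchstab_adjoint.

Lemma smallest_zero (R : realType) (f : R -> R) (l0 l1 : R) : l0 <= l1 ->
  (forall l, {for l, continuous f}) -> (forall l, l < l0 -> 0 < f l) ->
  f l1 <= 0 ->
  exists m, [/\ l0 <= m <= l1, f m = 0 & forall l, f l = 0 -> m <= l].
Proof.
move=> l01 cf fpos fl1; pose Z := [set l : R | f l = 0].
have Zl0 : lbound Z l0.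
  by move=> l /= fl; rewrite leNgt; apply/negP => /fpos; rewrite fl ltxx.
have [z z1 fz] : exists2 z, z <= l1 & f z = 0.
  have l0' : 0 < f (l0 - 1) by apply: fpos; lra.
  have [|||z] := @IVT R f (l0 - 1) l1 0.
  - lra.
  - exact: continuous_subspaceT.
  - by rewrite ge_min fl1 orbT le_max (ltW l0').
  by rewrite in_itv/= => /andP[_ zl] fz; exists z.
have hZ : has_inf Z by split; [exists z|exists l0].
have inf_le (l : R) : f l = 0 -> inf Z <= l by move=> fl; apply: ge_inf => //; exists l0.
exists (inf Z); split => //.
  by rewrite lb_le_inf//; [rewrite (le_trans (inf_le z fz))|exists z].
(* A nonzero value at the infimum would persist nearby, although zeros come arbitrarily close to
   it. *)
apply: contrapT => /eqP fm.
have nz : \forall l \near inf Z, f l != 0 by exact: (cvgr_neq0 _ (cf (inf Z)) fm).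
have [e /= e0 he] := nz.
have [l /= fl lt_l] := inf_adherent e0 hZ.
have := he l; rewrite /= fl eqxx => /(_ _)/negP; apply => //.
rewrite distrC ger0_norm ?subr_ge0; first by rewrite ltrBlDr addrC.
exact: inf_le.
Qed.

(** * Two-sided bounds for the exponent *)

Section exponent.
Context {R : realType} {omega : R -> R} (omegaP : is_buchstab omega).
Context {A : R} (A_gt0 : 0 < A) (decayA : rapid_decay (fun u => omega u - A)).
Local Notation Q := (@buchstab_adjoint R omega A).

Lemma buchstab_adjoint_gt0 (x l : R) : 1 < x -> l - 1 < x * (ln x - 1) -> 0 < Q x l.
Proof.
move=> x1 lx; have [X [C hX]] := buchstab_adjoint_large omegaP A_gt0 decayA l.
have x0 : 0 < x by lra.
apply: (@positive_above R (fun y => Q y l) (fun y => l * Q y (l - 1)) l (ln x) x X C) => //.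
- exact: ln_gt0.
- by move=> y; exact: buchstab_adjoint_is_derive.
- by move=> y; exact: buchstab_adjoint_equation.
- by rewrite lnK//; lra.
Qed.

Lemma buchstab_adjoint_le0 (x d : R) : 0 < d <= 1 -> 2 <= ln x ->
  exists2 n : nat,
    n%:R <= x * (ln x - 1) + d * x + 2 * ln x ^+ 2 / d + 3 & Q x n%:R <= 0.
Proof.
move=> /andP[d0 d1]; set T := ln x => T2.
have x0 : 0 < x by rewrite ltNge; apply/negP => /ln0 h; move: T2; rewrite /T h; lra.
have eT : expR T = x by rewrite lnK.
(* For w >= M the factor w + x - x T is at least d x, so the middle condition only asks H/2 - 1/4 >=
   T^2 / d; this dictates z. The successor after truncation gives M > y and H > z. *)
pose y := x * (T - 1) + d * x; pose z := 2 * T ^+ 2 / d + 2^-1.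
have y0 : 0 <= y by rewrite addr_ge0// mulr_ge0//; lra.
have z0 : 0 <= z by rewrite addr_ge0// divr_ge0// ?mulr_ge0 ?sqr_ge0//; lra.
have /andP[M1 M2] := truncn_itv y0; have /andP[H1 H2] := truncn_itv z0.
set M := (Num.truncn y).+1 in M2; set H := (Num.truncn z).+1 in H2.
have Mle : M%:R <= y + 1 by rewrite /M -natr1 lerD2r.
have Hle : H%:R <= z + 1 by rewrite /H -natr1 lerD2r.
have zT : 4 * T <= z.
  have : 2 * T ^+ 2 <= 2 * T ^+ 2 / d.
    by rewrite ler_pdivlMr// ler_piMr// mulr_ge0// sqr_ge0.
  have : 2 * T <= T ^+ 2 by rewrite expr2 ler_wpM2r//; lra.
  rewrite /z; lra.
have T0 : 0 < T by lra.
(* Here T >= 2 gives both H >= 4 T and x T - x >= x T / 2. *)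
have start : x * T ^+ 2 <= (2 * H%:R + 1) / 4 * (x * T - x + 1).
  have a : 2 * T <= (2 * H%:R + 1) / 4 by lra.
  have b : x * T / 2 <= x * T - x + 1.
    by have := ler_wpM2l (ltW x0) T2; lra.
  have -> : x * T ^+ 2 = 2 * T * (x * T / 2) by field.
  by apply: ler_pM => //; [lra|rewrite divr_ge0// mulr_ge0//; lra].
have mid (w : R) : M%:R <= w -> x * T ^+ 2 <= (H%:R / 2 - 4^-1) * (w + x - x * T).
  move=> Mw; have a : d * x <= w + x - x * T by move: M2; rewrite /y; lra.
  have b : T ^+ 2 / d <= H%:R / 2 - 4^-1 by move: H2; rewrite /z; lra.
  have -> : x * T ^+ 2 = T ^+ 2 / d * (d * x) by field; rewrite gt_eqF.
  apply: ler_pM => //; last by rewrite mulr_ge0// ltW.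
  by rewrite divr_ge0 ?sqr_ge0// ltW.
have [n nMH fn] := positivity_breaks T0 eT
  (buchstab_adjoint_coeff_rec omegaP A_gt0 decayA x0) start (ltn0Sn _) mid.
exists n.
  have : n%:R <= M%:R + H%:R :> R by rewrite -natrD ler_nat.
  by move: Mle Hle; rewrite /y /z; lra.
by move: fn; rewrite pmulr_lle0// invr_gt0 ltr0n fact_gt0.
Qed.

(** The factor relating g to Q is positive and l = - s, so the largest zero of g is minus the
    smallest zero of Q in l. *)
Lemma lambda_bounds (a d : R) : A = expR (- euler_gamma R) -> 0 < a ->
  0 < d <= 1 -> 2 <= ln a^-1 ->
  1 + a^-1 * (ln a^-1 - 1) <= lambda omega a <=
    a^-1 * (ln a^-1 - 1) + d * a^-1 + 2 * ln a^-1 ^+ 2 / d + 3.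
Proof.
move=> AE a0 d01; set x := a^-1 => T2.
have x0 : 0 < x by rewrite invr_gt0.
have x1 : 1 < x.
  rewrite ltNge; apply/negP => /ln_le0 h; move: T2; lra.
have [n nle Qn] := buchstab_adjoint_le0 d01 T2.
have Qpos (l : R) : l < 1 + x * (ln x - 1) -> 0 < Q x l.
  by move=> h; apply: buchstab_adjoint_gt0 => //; lra.
have nge : 1 + x * (ln x - 1) <= n%:R.
  by rewrite leNgt; apply/negP => /Qpos; rewrite ltNge Qn.
have cQ (l : R) : {for l, continuous (Q x)}.
  exact: buchstab_adjoint_continuous.
have [m [/andP[m1 m2] Qm mmin]] := smallest_zero nge cQ Qpos Qn.
have gE (s : R) := g_buchstab_adjoint omegaP A_gt0 decayA s AE a0.
have largest : is_largest_zero (g omega a) (- m).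
  split=> [|s]; first by rewrite gE opprK Qm mulr0.
  rewrite gE => /eqP; rewrite mulf_eq0 mulf_eq0 (gt_eqF A_gt0) (gt_eqF (powR_gt0 _ x0))/=.
  by move=> /eqP/mmin; rewrite lerNr.
have xE : largest_zero (g omega a) = - m.
  (* The witness - m ensures that [xget] does not return its default value. *)
  have [h1 h2] : is_largest_zero (g omega a) (largest_zero (g omega a)).
    by apply: (@xgetPex _ _ [set y | is_largest_zero (g omega a) y]); exists (- m).
  apply/eqP; rewrite eq_le; case: largest => l1 l2.
  by apply/andP; split; [exact: l2|exact: h2].
by rewrite /lambda xE opprK m1 (le_trans m2).
Qed.

End exponent.

(** From T^3 / 6 <= e^T at T = ln x. *)
Lemma sqr_ln_le (R : realType) (x : R) : 1 < x -> ln x ^+ 2 <= 6 * x / ln x.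
Proof.
move=> x1; have T0 := ln_gt0 x1.
rewrite ler_pdivlMr// -exprSr mulrC.
have := expR_ge1Dxn 2 (ltW T0); rewrite lnK ?posrE; last lra.
rewrite (_ : (3`!)%:R = 6 :> R)//; lra.
Qed.

(** T >= 24/d^2 makes 2 T^2 / d <= 12 x / (d T) at most d x / 2, and x > T >= 6/d does the same for
    the constant 3; the total error is at most 2 d x <= e x. *)
Lemma exponent_error (R : realType) (d e T x lam : R) : 0 < d -> d <= e / 2 ->
  24 / d ^+ 2 + 6 / d + 2 <= T -> T < x -> T ^+ 2 <= 6 * x / T ->
  1 + x * (T - 1) <= lam <= x * (T - 1) + d * x + 2 * T ^+ 2 / d + 3 ->
  `|x^-1 * lam - T + 1| <= e.
Proof.
move=> d0 de TT Tx Tsq /andP[l1 l2].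
have dd : 0 < d ^+ 2 by rewrite exprn_gt0.
have i1 : 0 < 24 / d ^+ 2 by rewrite divr_gt0.
have i2 : 0 < 6 / d by rewrite divr_gt0.
have T1 : 24 / d ^+ 2 <= T by lra.
have T2 : 6 / d <= T by lra.
have T0 : 0 < T by lra.
have x0 : 0 < x by lra.
have Td1 : 24 <= T * d ^+ 2 by rewrite -ler_pdivrMr.
have Td2 : 6 <= T * d by rewrite -ler_pdivrMr.
have s1 : 2 * T ^+ 2 / d <= d / 2 * x.
  rewrite ler_pdivrMr//.
  have h : 6 * x / T <= d ^+ 2 / 4 * x.
    by rewrite ler_pdivrMr// mulrAC ler_pM2r//; lra.
  have := le_trans Tsq h; lra.
have s2 : 3 <= d / 2 * x by have := ler_wpM2r (ltW d0) (ltW Tx); lra.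
have -> : x^-1 * lam - T + 1 = (lam - x * (T - 1)) / x by field; rewrite gt_eqF.
rewrite ger0_norm; last by rewrite divr_ge0 ?(ltW x0)//; lra.
by rewrite ler_pdivrMr//; have := ler_wpM2r (ltW x0) de; lra.
Qed.

Theorem theorem6 (R : realType) (omega : R -> R) (homega : is_buchstab omega) :
  exists eps : R -> R,
    eps a @[a --> 0^'+] --> 0 /\
    forall a : R, 0 < a ->
      lambda omega a = a^-1 * (ln a^-1 - 1 + eps a).
Proof.
have [A A2 decayA] := buchstab_limit homega.
have A0 : 0 < A by lra.
have AE := buchstab_limit_euler homega A0 decayA.
(* The identity is solved for the error term, so only its limit needs an argument. *)
exists (fun a => a * lambda omega a - ln a^-1 + 1); split; last first.
  by move=> a a0; field; rewrite gt_eqF.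
apply/cvgrPdist_le => e e0.
pose d := Num.min 1 (e / 2).
have [d0 d1 de] : [/\ 0 < d, d <= 1 & d <= e / 2].
  by rewrite lt_min ge_min lexx ltr01 divr_gt0// ge_min lexx orbT.
pose T0 := 24 / d ^+ 2 + 6 / d + 2.
have dd : 0 < d ^+ 2 by rewrite exprn_gt0.
near=> a.
have a0 : 0 < a by near: a; exact: nbhs_right_gt.
have aT : a < expR (- T0) by near: a; apply: nbhs_right_lt; exact: expR_gt0.
have x0 : 0 < a^-1 by rewrite invr_gt0.
have TT : T0 <= ln a^-1.
  by rewrite lnV ?posrE// lerNr -(expRK (- T0)) ler_ln ?posrE ?expR_gt0// ltW.
have T2 : 2 <= ln a^-1.
  by apply: le_trans TT; rewrite lerDr addr_ge0// divr_ge0// ltW.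
have d01 : 0 < d <= 1 by rewrite d0.
have := lambda_bounds homega A0 decayA AE a0 d01 T2.
have x1 : 1 < a^-1.
  by rewrite ltNge; apply/negP => /ln_le0 h; move: T2; lra.
move=> bnd.
have := exponent_error d0 de TT (ln_sublinear x0) (sqr_ln_le x1) bnd.
by rewrite invrK sub0r normrN.
Unshelve. all: by end_near. Qed.
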